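(* Let $m,n\ge0$, $\kappa\in\mathcal F^{\mathrm{BV}}_m$ and $\eta\in\mathcal F^{\mathrm{BV}}_n$. Then $$W(\kappa)W(\eta)-W(\kappa\star\eta)\in\mathcal S_2.$$ More precisely, there are $C>0$ and $q=q(m,n)>0$ (for instance $q=2(m+n+1)$) such that for all $j,l\ge0$, with $a=j+1$ and $b=l+1$, $$\bigl|[W(\kappa)W(\eta)-W(\kappa\star\eta)]_{jl}\bigr|\le C\,\frac{(1+\log a)^q(1+\log b)^q}{ab}.$$
   Context: $H^2$ is the Hardy space of the disc with orthonormal basis $e_n(z)=z^n$, $n\ge0$, and $\mathcal S_2$ denotes the Hilbert–Schmidt operators on $H^2$. For a pointwise-defined kernel $\kappa:(0,\infty)\to\mathbb C$, $W(\kappa)$ is the matrix $W(\kappa)_{jk}=\frac1{j+1}\kappa\!\left(\frac{k+1}{j+1}\right)$, $j,k\ge0$; it defines a bounded operator on $H^2$ for every $\kappa$ in the classes below. Multiplicative convolution: $(\kappa\star\eta)(w)=\int_0^\infty\kappa(u)\,\eta(w/u)\,\frac{du}{u}$. Logarithmic profile: $f_\kappa(t)=e^{t/2}\kappa(e^t)$, $t\in\mathbb R$. Weights: $\mu_m(t)=(1+|t|)^me^{-|t|/2}$. If $f:\mathbb R\to\mathbb C$ is locally of bounded variation and continuous outside a finite set $J$, put, for $\tau\in J$, $E_f(\tau)=|f(\tau)-f(\tau^-)|+|f(\tau^+)-f(\tau)|-|f(\tau^+)-f(\tau^-)|$ and $|Df|=|df|+\sum_{\tau\in J}E_f(\tau)\delta_\tau$,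 where $df$ is the distributional derivative (a Radon measure) and $|df|$ its total variation measure. A kernel $\kappa$ belongs to $\mathcal F^{\mathrm{BV}}_m$ if $f_\kappa$ is locally of bounded variation and there are $K>0$ and a finite set $J\subset\mathbb R$ such that $f_\kappa$ is continuous on $\mathbb R\setminus J$, $|f_\kappa(t)|\le K\mu_m(t)$ for all $t$, and $|Df_\kappa|\le K\mu_m(t)\bigl(dt+\sum_{\tau\in J}\delta_\tau\bigr)$ as measures. *)

(* Defs.v *)
From HB Require Import structures.
From mathcomp Require Import all_boot all_order all_algebra.
From mathcomp Require Import finmap lra.
From mathcomp Require Import all_classical all_reals all_analysis.
From mathcomp Require Export complex.

Set Implicit Arguments.
Unset Strict Implicit.
Unset Printing Implicit Defensive.

Import Order.TTheory GRing.Theory Num.Theory.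
Import numFieldNormedType.Exports.

Local Open Scope classical_set_scope.
Local Open Scope ring_scope.
Local Open Scope complex_scope.

HB.instance Definition _ (R : realType) := NormedModule.copy R[i] R[i]^o.

(* The R-valued modulus of a complex number (`|z| is R[i]-valued). *)
Notation normc := ComplexField.Normc.normc.

(** * The Hardy space and its operators *)

Definition normsq (R : realType) (a : nat -> R[i]) : \bar R :=
  (\sum_(0 <= k <oo) (normc (a k) ^+ 2)%:E)%E.

Definition square_summable (R : realType) : {pred nat -> R[i]} :=
  fun a => `[< (normsq a < +oo)%E >].

Lemma square_summable_submod_closed (R : realType) :
  submod_closed (@square_summable R).
Proof.
have normc_ge0 (z : R[i]) : 0 <= normc z by case: z => x y; exact: sqrtr_ge0.
split=> [|c a b /asboolP ha /asboolP hb]; apply/asboolP.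
  by rewrite /normsq eseries0// => k _ _; rewrite ComplexField.Normc.normc0 expr0n.
have h0 (x : nat -> R[i]) k : (0 <= (normc (x k) ^+ 2)%:E)%E.
  by rewrite lee_fin sqr_ge0.
pose K := 2 * normc c ^+ 2.
have K0 : 0 <= K by rewrite mulr_ge0// sqr_ge0.
apply: (@le_lt_trans _ _ (K%:E * normsq a + 2%:E * normsq b)%E); last first.
  by rewrite lte_add_pinfty// lte_mul_pinfty// ?lee_fin.
rewrite /normsq -!nneseriesZl//.
rewrite -nneseriesD; [|by move=> k _ _; rewrite mule_ge0// lee_fin..].
apply: lee_nneseries => [k _ _|k _]; first exact: (h0 (c *: a + b)).
rewrite -!EFinM -EFinD lee_fin.
have /le_trans -> // : normc (c * a k + b k) ^+ 2 <=
    (normc c * normc (a k) + normc (b k)) ^+ 2.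
  rewrite ler_sqr ?nnegrE ?addr_ge0 ?mulr_ge0//.
  rewrite -ComplexField.Normc.normcM.
  exact: (@ler_normD _ (Rcomplex R)).
rewrite /K -mulrA -exprMn -mulrDr.
move: (normc c * _) (normc (b k)) => x y.
rewrite -subr_ge0 (_ : _ - _ = (x - y) ^+ 2) ?sqr_ge0//.
by rewrite sqrrB sqrrD mulr_natl !mulr2n; lra.
Qed.

HB.instance Definition _ (R : realType) :=
  GRing.isSubmodClosed.Build _ _ (@square_summable R)
    (square_summable_submod_closed R).

(* A function F(z) = \sum_n a_n z^n of H^2 is represented by its sequence
   [taylor F] of Taylor coefficients. *)
Record hardy (R : realType) := Hardy {
  taylor :> nat -> R[i];
  taylorP : taylor \in @square_summable R }.

HB.instance Definition _ (R : realType) := [isSub for @taylor R].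
HB.instance Definition _ (R : realType) := [Choice of hardy R by <:].
HB.instance Definition _ (R : realType) :=
  [SubChoice_isSubLmodule of hardy R by <:].

Section hardy_operators.
Context {R : realType}.
Implicit Types (F : hardy R) (T : {linear hardy R -> hardy R}).

Definition hardy_norm F : R := Num.sqrt (fine (normsq F)).

Lemma monomial_square_summable n :
  (fun k => (k == n)%:R) \in @square_summable R.
Proof.
apply/asboolP; rewrite /normsq (nneseries_split 0 n.+1); last first.
  by move=> k _; rewrite lee_fin sqr_ge0.
rewrite [X in (_ + X)%E]eseries0 ?adde0 ?sumEFin ?ltry// => k nk _.
by rewrite gtn_eqF// ComplexField.Normc.normc0 expr0n.
Qed.

Definition monomial (n : nat) : hardy R := Hardy (monomial_square_summable n).

Definition bounded_operator T :=
  exists M : R, forall F, hardy_norm (T F) <= M * hardy_norm F.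

(* The entry <T e_k, e_j>. *)
Definition op_matrix T (j k : nat) : R[i] := T (monomial k) j.

Definition is_operator_of (M : nat -> nat -> R[i]) T :=
  bounded_operator T /\ forall j k, op_matrix T j k = M j k.

Definition hilbert_schmidt T :=
  bounded_operator T /\
  (\sum_(0 <= k <oo) normsq (T (monomial k)) < +oo)%E.

End hardy_operators.

Section kernels.
Context {R : realType}.
Implicit Types (f kappa eta : R -> R[i]) (A : set R) (J : {fset R}).

Local Notation leb := (@lebesgue_measure R).

Definition complex_integral A f : R[i] :=
  Rintegral leb A (fun x => complex.Re (f x)) +i* Rintegral leb A (fun x => complex.Im (f x)).

(* Only the values of kappa on (0, +oo) are used here and below. *)
Definition W kappa (j k : nat) : R[i] :=
  (j.+1%:R^-1)%:C * kappa (k.+1%:R / j.+1%:R).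

Definition mconv kappa eta (w : R) : R[i] :=
  complex_integral `]0, +oo[ (fun u => kappa u * eta (w / u) * (u^-1)%:C).

Definition profile kappa (t : R) : R[i] := (expR (t / 2))%:C * kappa (expR t).

Definition weight (m t : R) : R := (1 + `|t|) `^ m * expR (- `|t| / 2).

(** * Functions locally of bounded variation and their derivatives *)

Definition cvariation (a b : R) f (s : seq R) : R :=
  \sum_(0 <= i < size s) normc (f (nth b (a :: s) i.+1) - f (nth b (a :: s) i)).

Definition locally_BV f := forall a b : R, a <= b ->
  exists M : R, forall s, itv_partition a b s -> cvariation a b f s <= M.

Definition locally_finite (mu : set (measurableTypeR R) -> \bar R) :=
  forall a b : R, (mu `[a, b]%classic < +oo)%E.

(* A complex Radon measure p - q + i (r - s) on the line, given by four locally
   finite Borel measures; its values are finite on bounded Borel sets only. *)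
Record cradon := CRadon {
  re_pos : {measure set (measurableTypeR R) -> \bar R};
  re_neg : {measure set (measurableTypeR R) -> \bar R};
  im_pos : {measure set (measurableTypeR R) -> \bar R};
  im_neg : {measure set (measurableTypeR R) -> \bar R};
  re_posP : locally_finite re_pos;
  re_negP : locally_finite re_neg;
  im_posP : locally_finite im_pos;
  im_negP : locally_finite im_neg }.

(* [fine] sends +oo to 0: meaningful on bounded Borel sets only. *)
Definition cradon_val (D : cradon) (A : set (measurableTypeR R)) : R[i] :=
  (fine (re_pos D A) - fine (re_neg D A)) +i*
  (fine (im_pos D A) - fine (im_neg D A)).

Definition cradon_integral (D : cradon) (phi : measurableTypeR R -> R) : R[i] :=
  (Rintegral (re_pos D) setT phi - Rintegral (re_neg D) setT phi) +i*
  (Rintegral (im_pos D) setT phi - Rintegral (im_neg D) setT phi).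

(* The value at A of the total variation measure of D. *)
Definition cradon_variation (D : cradon) (A : set (measurableTypeR R)) : \bar R :=
  ereal_sup [set v | exists n (B : nat -> set (measurableTypeR R)),
    [/\ forall i, measurable (B i) /\ B i `<=` A /\ bounded_set (B i : set R),
        trivIset setT B
      & v = (\sum_(i < n) normc (cradon_val D (B i)))%:E]].

(* Real-valued test functions suffice: the pairing is complex-linear. *)
Definition test_function (phi : R -> R) :=
  (forall n x, derivable (phi^`(n))%classic x 1) /\
  exists M : R, forall x, M < `|x| -> phi x = 0.

Definition distributional_derivative f (D : cradon) :=
  forall phi, test_function phi ->
    cradon_integral D phi = - complex_integral setT (fun x => (phi^`()%classic x)%:C * f x).

Definition excess f (tau : R) : R :=
  let fl := lim (f t @[t --> tau^'-]) in
  let fr := lim (f t @[t --> tau^'+]) in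
  normc (f tau - fl) + normc (fr - f tau) - normc (fr - fl).

(* D is the distributional derivative of f, unique as a complex measure, so its
   variation does not depend on the chosen decomposition. *)
Definition FBV (m : R) kappa :=
  let f := profile kappa in
  locally_BV f /\
  exists (K : R) (J : {fset R}) (D : cradon),
    [/\ 0 < K,
        forall t, t \notin J -> {for t, continuous f},
        forall t, normc (f t) <= K * weight m t,
        distributional_derivative f D
      & forall A : set (measurableTypeR R), measurable A ->
          (cradon_variation D A + \sum_(tau <- J) (excess f tau)%:E * \d_tau A <=
           K%:E * (\int[leb]_(t in A) (weight m t)%:E +
                   \sum_(tau <- J) (weight m tau)%:E * \d_tau A))%E].

End kernels.
Arguments cradon : clear implicits.

(* Main.v *)
(* With a = j + 1, b = l + 1, w = b / a and F(u) = kappa(u) eta(w / u) / u, the (j, l)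
   entry of W(kappa) W(eta) is 1/a times the Riemann sum of F over the points c / a,
   c >= 1, with step 1 / a, while that of W(kappa * eta) is 1/a times the integral of F.
   On a cell [c / a, (c + 1) / a) free of jumps, F varies by at most 1 / c times its
   size, because the profiles are Lipschitz there with constant a multiple of the
   weight; at the boundedly many cells that contain a jump the bound on |F| suffices.
   The size of F at c / a is (a / b) polylog (a b) min (1, max (a, b) / c)^{3/2}, and
   summing over c only costs another logarithm.

   The Lipschitz bound comes from testing the distributional derivative against the
   difference of two smooth steps concentrated near x and y.  Boundedness of W(kappa)
   on H^2 is Schur's test; W(kappa * eta) is bounded as the difference of
   W(kappa) W(eta) and a Hilbert-Schmidt operator. *)
From HB Require Import structures.
Require Import Defs.
From mathcomp Require Import all_boot all_order all_algebra.
From mathcomp Require Import finmap ring lra.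
From mathcomp Require Import all_classical all_reals all_analysis.
From mathcomp Require Import measurable_realfun.

Set Implicit Arguments.
Unset Strict Implicit.
Unset Printing Implicit Defensive.

Import Order.TTheory GRing.Theory Num.Theory.
Import numFieldNormedType.Exports.
Local Open Scope classical_set_scope.
Local Open Scope ring_scope.

(** * Smooth steps *)

(** The exponents come from giving up a little decay to get rid of logarithms. Relative to a / b,
    the exponential factors of the integrand at x = a u are of size x^0 for x < 1 and at most (max
    (a, b) / x)^2 for x > max (a, b). Outside [1, max (a, b)] the powers of the distance of log x to
    this range cost half an exponent, which leaves x^{-1/2}, still integrable at 0, and (max (a, b)
    / x)^{3/2}; the powers of log a and log b are kept. In the same way a quarter power pays for the
    logarithms in the matrix of W(kappa) and in the defect, whose entries become O((a b)^{-3/4}) and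
    hence square summable.

    The Riemann sum has no node at u = 0, so the cell ]0, 1 / a[ enters only through the integral of
    |F| over it, and the constant there must not grow with max (a, b).

    Measures, integrals and series are compared through real and imaginary parts, which is the
    origin of several factors 2. *)

Fixpoint differentiable_upto (R : realType) (n : nat) (f : R -> R) : Prop :=
  if n is k.+1 then
    exists2 g : R -> R, (forall x : R, is_derive x (1 : R) f (g x)) & differentiable_upto k g
  else True.

Section differentiable_upto.
Context {R : realType}.
Implicit Types f g : R -> R.

Lemma differentiable_uptoW n f :
  differentiable_upto n.+1 f -> differentiable_upto n f.
Proof.
elim: n f => //= n IH f [g fg hg]; exists g => //; exact: IH.
Qed.

Lemma differentiable_upto_cst n (c : R) : differentiable_upto n (cst c).
Proof.
elim: n c => //= n IH c; exists (cst 0) => [x|]; last exact: IH.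
exact: is_derive_cst.
Qed.

Lemma differentiable_uptoD n f g :
  differentiable_upto n f -> differentiable_upto n g ->
  differentiable_upto n (fun x => f x + g x).
Proof.
elim: n f g => //= n IH f g [f' ff' hf] [g' gg' hg].
exists (fun x => f' x + g' x) => [x|]; last exact: IH.
exact: is_deriveD.
Qed.

Lemma differentiable_uptoM n f g :
  differentiable_upto n f -> differentiable_upto n g ->
  differentiable_upto n (fun x => f x * g x).
Proof.
elim: n f g => //= n IH f g [f' ff' hf] [g' gg' hg].
exists (fun x => f x * g' x + g x * f' x) => [x|].
  exact: is_deriveM.
apply: differentiable_uptoD; apply: IH => //; apply: differentiable_uptoW.
- by exists f'.
- by exists g'.
Qed.

Lemma differentiable_upto_comp n f g :
  differentiable_upto n f -> differentiable_upto n g ->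
  differentiable_upto n (fun x => g (f x)).
Proof.
elim: n f g => //= n IH f g [f' ff' hf] [g' gg' hg].
exists (fun x => g' (f x) * f' x) => [x|].
  exact: is_derive1_comp.
apply: differentiable_uptoM => //; apply: IH => //.
by apply: differentiable_uptoW; exists f'.
Qed.

Lemma differentiable_upto_affine n (a b : R) :
  differentiable_upto n (fun x => a * x + b).
Proof.
case: n => //= n; exists (cst a) => [x|]; last exact: differentiable_upto_cst.
by apply: is_derive_eq; rewrite addr0 /GRing.scale /= mulr1 ?mulr0 ?addr0.
Qed.

(** The induction on n must keep all remaining orders: the n-th derivative is shown to be
    differentiable up to every order k, and order k + 1 at step n supplies order k at step n + 1. *)
Lemma differentiable_upto_derivable f :
  (forall n, differentiable_upto n f) ->
  forall n x, derivable (f^`(n))%classic x 1.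
Proof.
move=> hf n x.
suff [g hg _] : differentiable_upto 1 (f^`(n))%classic by case: (hg x).
elim: n (1%N) => [k|n IH k]; first exact: hf.
rewrite derive1nS.
have [g hg hg'] := IH k.+1.
suff -> : ((f^`(n))^`())%classic = g by [].
by apply/funext => y; rewrite derive1E; case: (hg y).
Qed.

End differentiable_upto.

(** Serves at the origin, where [flat_exp] is glued from two formulas and no rule of differentiation
    applies. *)
Lemma is_derive_quadratic_bound {R : realType} (f : R -> R) (C : R) :
  (forall x, `|f x| <= C * x ^+ 2) -> is_derive (0 : R) (1 : R) f 0.
Proof.
move=> fC.
have C0 : 0 <= C by move: (fC 1); rewrite expr1n mulr1; exact: le_trans.
have f0 : f 0 = 0 by apply/eqP; rewrite -normr_le0 (le_trans (fC _))// expr0n mulr0.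
have h : h^-1 *: ((f \o shift 0) (h *: (1 : R)) - f 0) @[h --> (0:R)^'] --> (0 : R).
  apply/cvgr0Pnorm_le => e e0.
  near=> h.
  rewrite /= /GRing.scale /= addr0 mulr1 f0 subr0 normrM normfV.
  have h0 : h != 0 by near: h; exact: nbhs_dnbhs_neq.
  rewrite ler_pdivrMl ?normr_gt0// (le_trans (fC _))// -real_normK ?num_real// expr2.
  rewrite mulrA mulrC ler_wpM2l//.
  have : `|h| <= e / (C + 1).
    by near: h; apply: dnbhs0_le; rewrite divr_gt0// ltr_wpDl.
  rewrite ler_pdivlMr ?ltr_wpDl//; apply: le_trans.
  by rewrite mulrC ler_wpM2l// lerDl.
by split; [apply/cvg_ex; exists 0 | exact/cvg_lim].
Unshelve. all: by end_near. Qed.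

(** The exponent k is a parameter because differentiation maps the family t^{-k} e^{-1/t} into its
    own span; smoothness of all members then follows by one induction on the order. *)
Definition flat_exp {R : realType} (k : nat) (t : R) : R :=
  if 0 < t then t^-1 ^+ k * expR (- t^-1) else 0.

Section flat_exp.
Context {R : realType}.
Implicit Types t : R.

Lemma flat_exp_ge0 k t : 0 <= flat_exp k t.
Proof.
by rewrite /flat_exp; case: ifP => // t0; rewrite mulr_ge0 ?expR_ge0// exprn_ge0// invr_ge0 ltW.
Qed.

Lemma flat_exp_le0 k t : t <= 0 -> flat_exp k t = 0.
Proof. by rewrite /flat_exp leNgt => /negbTE ->. Qed.

Lemma flat_exp0_gt0 t : 0 < t -> 0 < flat_exp 0 t.
Proof. by rewrite /flat_exp => ->; rewrite expr0 mul1r expR_gt0. Qed.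

Lemma ler_flat_exp0 : {homo (@flat_exp R 0) : x y / x <= y}.
Proof.
move=> x y xy; have [x0|x0] := leP x 0; first by rewrite flat_exp_le0 ?flat_exp_ge0.
have y0 : 0 < y by exact: lt_le_trans xy.
by rewrite /flat_exp x0 y0 !expr0 !mul1r ler_expR lerN2 lef_pV2.
Qed.

(** For x = 1 / t > 0 the exponential series gives e^x >= x^{k+2} / (k+2)!; two of these powers
    survive division by x^k. *)
Lemma flat_exp_quadratic k t : `|flat_exp k t| <= k.+2`!%:R * t ^+ 2.
Proof.
rewrite ger0_norm ?flat_exp_ge0// /flat_exp; case: ifPn => t0; last first.
  by rewrite mulr_ge0 ?sqr_ge0.
rewrite expRN -ler_pdivlMr ?invr_gt0 ?expR_gt0// invrK.
have := @expR_ge1Dxn R t^-1 k.+1; rewrite invr_ge0 => /(_ (ltW t0)) h.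
have f0 : 0 < k.+2`!%:R :> R by rewrite ltr0n fact_gt0.
have : t^-1 ^+ k.+2 / k.+2`!%:R <= expR t^-1 by apply: le_trans h; rewrite lerDr.
rewrite ler_pdivrMr// => {}h.
have -> : t^-1 ^+ k = t ^+ 2 * t^-1 ^+ k.+2.
  by rewrite !exprS expr0 mulr1; field; rewrite gt_eqF.
by rewrite [leRHS]mulrAC [leRHS]mulrC ler_wpM2l ?sqr_ge0// mulrC.
Qed.

Lemma is_derive_flat_exp k t :
  is_derive t (1 : R) (flat_exp k) (flat_exp k.+2 t - k%:R * flat_exp k.+1 t).
Proof.
have [t0|t0|->] := ltgtP t 0.
- rewrite !flat_exp_le0 ?ltW// mulr0 subr0.
  apply: (@near_eq_is_derive R R R (cst (0:R))).
  near=> s; rewrite flat_exp_le0// ltW//; near: s; exact: lt_nbhsl.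
- apply: (@near_eq_is_derive R R R (fun s : R => s^-1 ^+ k * expR (- s^-1))).
    near=> s; rewrite /flat_exp ifT//; near: s; exact: lt_nbhsr.
  have tN0 : t != 0 by rewrite gt_eqF.
  have dV : is_derive t (1 : R) (fun s : R => s^-1) (- t ^- 2).
    apply: is_derive_eq; first exact: is_deriveV.
    by rewrite /GRing.scale /= mulr1.
  have dE : is_derive t (1:R) (fun s : R => expR (- s^-1)) (expR (- t^-1) * t ^- 2).
    rewrite -[X in _ * X]opprK.
    exact: (@is_derive1_comp R expR (fun s => - s^-1) _ _ _ _ (is_deriveN dV)).
  have dX := is_deriveX k dV; rewrite exprfctE in dX.
  apply: (is_derive_eq (is_deriveM dX dE)).
  rewrite /flat_exp t0 /GRing.scale /=.
  by case: k {dX} => [|k] /=; rewrite ?expr0 !exprS; field.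
- rewrite !flat_exp_le0// mulr0 subr0.
  exact: is_derive_quadratic_bound (flat_exp_quadratic k).
Unshelve. all: by end_near. Qed.
End flat_exp.

Section smooth_step.
Context {R : realType}.

Lemma differentiable_upto_flat_exp n k : differentiable_upto n (@flat_exp R k).
Proof.
elim: n k => //= n IH k; eexists; first exact: is_derive_flat_exp.
apply: differentiable_uptoD; first exact: IH.
have -> : (fun x => - (k%:R * flat_exp k.+1 x)) = (fun x => - k%:R * @flat_exp R k.+1 x).
  by apply/funext => x; rewrite mulNr.
by apply: differentiable_uptoM => //; exact: differentiable_upto_cst.
Qed.

(* The composite t |-> h (h 1 - h (1 - t)) with h t = exp (- 1 / t) is flat on both
   sides of [0, 1]. *)
Lemma smooth_step : exists psi dpsi : R -> R,
  [/\ forall n, differentiable_upto n psi,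
      forall t, is_derive t (1 : R) psi (dpsi t),
      forall t, 0 <= dpsi t,
      forall t, t <= 0 -> psi t = 0 /\ dpsi t = 0
    & forall t, 1 <= t -> psi t = 1 /\ dpsi t = 0].
Proof.
pose h : R -> R := flat_exp 0; pose c := h (h 1).
have c0 : 0 < c by rewrite !flat_exp0_gt0.
pose u t := h 1 - h (1 - t).
have du t : is_derive t (1 : R) u (flat_exp 2 (1 - t)).
  have d1 : is_derive t (1 : R) (fun t => 1 - t : R) (- 1).
    by apply: (is_derive_eq (is_deriveB (is_derive_cst (1 : R) t 1) (is_derive_id t 1)));
      rewrite sub0r.
  have d2 : is_derive t (1 : R) (fun t => h (1 - t)) (- flat_exp 2 (1 - t)).
    apply: (is_derive_eq (is_derive1_comp (is_derive_flat_exp 0 _) d1)).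
    by rewrite mul0r subr0 mulrN1.
  by apply: (is_derive_eq (is_deriveB (is_derive_cst (h 1) t 1) d2)); rewrite sub0r opprK.
exists (fun t => c^-1 * h (u t)), (fun t => c^-1 * (flat_exp 2 (u t) * flat_exp 2 (1 - t))).
have u0 t : t <= 0 -> u t <= 0.
  by move=> t0; rewrite subr_le0; apply: ler_flat_exp0; lra.
split=> [n|t|t|t t0|t t1].
- apply: differentiable_uptoM; first exact: differentiable_upto_cst.
  apply: differentiable_upto_comp; last exact: differentiable_upto_flat_exp.
  have -> : u = (fun t => h 1 + (- 1) * h ((- 1) * t + 1)).
    by apply/funext => t; rewrite /u !mulN1r (addrC _ 1).
  apply: differentiable_uptoD; first exact: differentiable_upto_cst.
  apply: differentiable_uptoM; first exact: differentiable_upto_cst.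
  apply: (differentiable_upto_comp (differentiable_upto_affine _ _ _)).
  exact: differentiable_upto_flat_exp.
- have d := is_derive1_comp (is_derive_flat_exp 0 (u t)) (du t).
  apply: (is_derive_eq (is_deriveZ c^-1 d)).
  by rewrite mul0r subr0.
- by rewrite !mulr_ge0 ?flat_exp_ge0// invr_ge0 ltW.
- by rewrite /h !(flat_exp_le0 _ (u0 _ t0)) !(mul0r, mulr0).
- have t1' : 1 - t <= 0 by rewrite subr_le0.
  have -> : u t = h 1 by rewrite /u /h (flat_exp_le0 _ t1') subr0.
  by rewrite (flat_exp_le0 _ t1') !mulr0 mulVf// gt_eqF.
Qed.

End smooth_step.

Section step_function.
Context {R : realType}.
Local Notation leb := (@lebesgue_measure R).

(** The derivative [k] is carried along as an averaging kernel: it is continuous, nonnegative,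
    supported in [x, y] and of integral 1. *)
Definition smooth_step_between (x y : R) (s k : R -> R) :=
  [/\ forall n, differentiable_upto n s,
      forall t, is_derive t (1 : R) s (k t),
      forall t, 0 <= k t,
      forall t, t <= x -> s t = 0 /\ k t = 0
    & forall t, y <= t -> s t = 1 /\ k t = 0].

Lemma smooth_step_betweenP (x y : R) : x < y ->
  exists s k : R -> R, smooth_step_between x y s k.
Proof.
move=> xy; have [psi [dpsi [sm dp p0 pl pr]]] := smooth_step (R := R).
pose a := (y - x)^-1; have a0 : 0 < a by rewrite invr_gt0 subr_gt0.
have affE t : (t - x) * a = a * t + - (a * x) by ring.
exists (fun t => psi (a * t + - (a * x))), (fun t => dpsi (a * t + - (a * x)) * a).
split=> [n|t|t|t tx|t ty].
- by apply: differentiable_upto_comp => //; exact: differentiable_upto_affine.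
- have da : is_derive t (1 : R) (fun t => a * t + - (a * x) : R) a.
    apply: (is_derive_eq (is_deriveD (is_deriveZ a (is_derive_id t (1 : R)))
      (is_derive_cst (- (a * x)) t 1))).
    by rewrite addr0 /GRing.scale /= mulr1.
  exact: (is_derive1_comp (dp _) da).
- by rewrite mulr_ge0// ltW.
- have h : a * t + - (a * x) <= 0 by rewrite -affE pmulr_lle0// subr_le0.
  by have [-> ->] := pl _ h; rewrite mul0r.
- have h : 1 <= a * t + - (a * x).
    by rewrite -affE ler_pdivlMr ?subr_gt0// mul1r lerD2r.
  by have [-> ->] := pr _ h; rewrite mul0r.
Qed.

Variables (x y : R) (s k : R -> R).
Hypotheses (xy : x < y) (sk : smooth_step_between x y s k).

Lemma smooth_step_between_continuous : continuous k.
Proof.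
(* Order 2 provides a differentiable derivative [g] of [s], and uniqueness of the derivative
   identifies it with [k]. *)
case: sk => + ds _ _ _ t; move=> /(_ 2%N) [g dg [h dh _]].
have -> : k = g.
  by apply/funext => u; case: (ds u) => _ <-; case: (dg u).
apply: differentiable_continuous; apply/derivable1_diffP.
by case: (dh t).
Qed.

Lemma smooth_step_between_ge0le1 t : 0 <= s t <= 1.
Proof.
case: sk => _ ds k0 sl sr.
have cs : continuous s.
  by move=> u; apply: differentiable_continuous; apply/derivable1_diffP; case: (ds u).
have mon u v : u <= v -> s u <= s v.
  move=> uv; apply: (@ger0_derive1_le_cc _ s u v) => //.
  - by move=> w _; rewrite derive1E; case: (ds w) => _ ->.
  - exact: continuous_subspaceT.
  - by rewrite bound_itvE.
  - by rewrite bound_itvE.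
apply/andP; split.
  have [<- _] := sl (Order.min t x) ltac:(by rewrite ge_min lexx orbT).
  by apply: mon; rewrite ge_min lexx.
have [<- _] := sr (Order.max t y) ltac:(by rewrite le_max lexx orbT).
by apply: mon; rewrite le_max lexx.
Qed.

Lemma integral_smooth_step_between : (\int[leb]_t (k t)%:E = 1)%E.
Proof.
case: (sk) => _ ds k0 sl sr.
have -> : (\int[leb]_t (k t)%:E = \int[leb]_(t in `[x, y]) (k t)%:E)%E.
  rewrite [RHS]integral_mkcond; apply: eq_integral => t _.
  rewrite patchE; case: ifPn => //; rewrite notin_setE /= in_itv /= => /negP.
  rewrite negb_and -!ltNge => /orP[|] /ltW.
    by move=> /sl[_ ->].
  by move=> /sr[_ ->].
rewrite (@continuous_FTC2 _ k s)//.
- by have [-> _] := sr _ (lexx y); have [-> _] := sl _ (lexx x); rewrite sube0.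
- exact/continuous_subspaceT/smooth_step_between_continuous.
- have cs : continuous s.
    by move=> t; apply: differentiable_continuous; apply/derivable1_diffP; case: (ds t).
  split.
  + by move=> t _; case: (ds t).
  + exact/cvg_at_right_filter/cs.
  + exact/cvg_at_left_filter/cs.
- by move=> t _; rewrite derive1E; case: (ds t).
Qed.

End step_function.

(** * Lipschitz bounds from the distributional derivative *)

Section average.
Context {R : realType}.
Local Notation leb := (@lebesgue_measure R).

(** As [k] has integral 1, the difference is the [k]-average of f - c, to which only the points of
    [x, y] contribute. *)
Lemma smooth_step_average (x y c B delta : R) (s k f : R -> R) :
  x < y -> smooth_step_between x y s k ->
  measurable_fun setT f -> (forall t, `|f t| <= B) ->
  (forall t, x <= t <= y -> `|f t - c| <= delta) ->
  leb.-integrable setT (EFin \o (fun t => k t * f t)) /\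
  `|Rintegral leb setT (fun t => k t * f t) - c| <= delta.
Proof.
move=> xy sk mf fB fc.
have ck := smooth_step_between_continuous sk.
have mk : measurable_fun setT k by exact: continuous_measurable_fun.
case: (sk) => _ _ k0 kl kr.
have ik1 := integral_smooth_step_between xy sk.
have ik : leb.-integrable setT (EFin \o k).
  apply/integrableP; split; first exact/measurable_EFinP.
  under eq_integral do rewrite /= ger0_norm//.
  by rewrite ik1 ltry.
have ikf : leb.-integrable setT (EFin \o (fun t => k t * f t)).
  apply: (le_integrable measurableT _ _ (integrableZl measurableT B ik)).
  - by apply/measurable_EFinP; exact: measurable_funM.
  - move=> t _ /=; rewrite lee_fin normrM (ger0_norm (k0 t)) mulrC.
    by rewrite (le_trans _ (ler_norm _))// ler_wpM2r.
split=> //.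
have iD : leb.-integrable setT (EFin \o (fun t => k t * f t - c * k t)).
  exact: (integrableB measurableT ikf (integrableZl measurableT c ik)).
have K1 : Rintegral leb setT k = 1 by rewrite /Rintegral ik1.
have -> : Rintegral leb setT (fun t => k t * f t) - c =
    Rintegral leb setT (fun t => k t * f t - c * k t).
  rewrite RintegralB//; last exact: (integrableZl measurableT _ ik).
  by rewrite RintegralZl// K1 mulr1.
apply: (le_trans (le_normr_Rintegral measurableT iD)).
have <- : Rintegral leb setT (fun t => delta * k t) = delta.
  by rewrite RintegralZl// K1 mulr1.
apply: le_Rintegral => //; first exact: (integrable_norm iD).
  exact: (integrableZl measurableT _ ik).
move=> t _; rewrite [c * _]mulrC -mulrBr normrM ger0_norm// [leRHS]mulrC.
have [tx|xt] := leP t x; first by have [_ ->] := kl _ tx; rewrite !mul0r.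
have [yt|ty] := leP y t; first by have [_ ->] := kr _ yt; rewrite !mul0r.
by rewrite ler_wpM2l// fc// !ltW.
Qed.

End average.

Section measure_comparison.
Context {R : realType}.
Local Notation leb := (@lebesgue_measure R).
Implicit Types p q : {measure set (measurableTypeR R) -> \bar R}.

(** Finiteness of [q] on [a, b] is essential: [Rintegral] reads an infinite integral as 0. It also
    makes the integral of phi against [p] finite. *)
Lemma le_Rintegral_of_measure_bound p q (a b K : R) (phi : measurableTypeR R -> R) :
  0 <= K -> a <= b -> (q `[a, b]%classic < +oo)%E ->
  (forall A : set (measurableTypeR R), measurable A -> A `<=` `[a, b]%classic ->
    (p A <= q A + K%:E * leb A)%E) ->
  measurable_fun setT phi -> (forall t, 0 <= phi t <= 1) ->
  (forall t, ~ `[a, b]%classic t -> phi t = 0) ->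
  Rintegral p setT phi <= Rintegral q setT phi + K * (b - a).
Proof.
move=> K0 ab qfin pq mphi phi01 phi0.
pose I : set (measurableTypeR R) := `[a, b]%classic.
have mI : measurable I by exact: measurable_itv.
have mIC : measurable (~` I) by exact: measurableC.
have phi_ge0 t : (0 <= (phi t)%:E)%E by rewrite lee_fin; case/andP: (phi01 t).
have mphiE : measurable_fun setT (EFin \o phi) by exact/measurable_EFinP.
have restr (r : {measure set (measurableTypeR R) -> \bar R}) :
    Rintegral r setT phi = fine (\int[r]_(t in I) (phi t)%:E)%E.
  rewrite /Rintegral [in RHS]integral_mkcond; congr fine; apply: eq_integral => t _.
  by rewrite patchE; case: ifPn => //; rewrite notin_setE => /phi0 ->.
(* Comparison of integrals wants [p] dominated on every measurable set, while the hypothesis covers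
   subsets of I only. Adding the part of [p] outside I repairs this and contributes nothing to
   integrals over I. *)
pose m2 : {measure set (measurableTypeR R) -> \bar R} :=
  measure_add (measure_add q (mscale (NngNum K0) leb)) (mrestr p mIC).
have bound (r : {measure set (measurableTypeR R) -> \bar R}) :
    (\int[r]_(t in I) (phi t)%:E <= r I)%E.
  rewrite -[leRHS]mul1e -integral_cst//; apply: ge0_le_integral => //.
  - exact: (measurable_funS measurableT _ mphiE).
  - by move=> t _; rewrite lee_fin; case/andP: (phi01 t).
have lebI : leb I = (b - a)%:E.
  rewrite /I lebesgue_measure_itv/= lte_fin; case: ltgtP ab => // -> _.
  by rewrite subrr.
have qphi : (\int[q]_(t in I) (phi t)%:E)%E \is a fin_num.
  by rewrite ge0_fin_numE ?integral_ge0// (le_lt_trans (bound q)).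
have : (\int[p]_(t in I) (phi t)%:E <=
        \int[q]_(t in I) (phi t)%:E + (K * (b - a))%:E)%E.
  have : (\int[p]_(t in I) (phi t)%:E <= \int[m2]_(t in I) (phi t)%:E)%E.
    apply: ge0_le_measure_integral => // S mS.
    have -> : m2 S = (q S + K%:E * leb S + p (S `&` ~` I))%E.
      apply: etrans (measure_addE _ _ S) _.
      by congr (_ + _)%E; exact: measure_addE.
    rewrite (measureDI p mS mI).
    have mSI : measurable (S `&` I) by exact: measurableI.
    rewrite -setDE addeC; apply: leeD => //.
    apply: (le_trans (pq _ mSI _)); first by move=> ? [].
    apply: leeD; first by rewrite le_measure// inE.
    by rewrite lee_pmul ?measure_ge0// ?lee_fin// le_measure// inE.
  move/le_trans; apply.
  rewrite ge0_integral_measure_add//; last exact: (measurable_funS measurableT _ mphiE).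
  rewrite [X in (_ + X)%E]null_set_integral//; last 2 first.
  - exact: (measurable_funS measurableT _ mphiE).
  - by rewrite [LHS](_ : _ = p (I `&` ~` I))// setICr measure0.
  rewrite adde0 ge0_integral_measure_add//; last exact: (measurable_funS measurableT _ mphiE).
  rewrite leeD2l// ge0_integral_mscale//; last exact: (measurable_funS measurableT _ mphiE).
  by rewrite EFinM lee_pmul ?integral_ge0// ?lee_fin// -lebI bound.
rewrite !restr -{1}(fineK qphi) -EFinD => h.
rewrite -lee_fin fineK// ge0_fin_numE ?integral_ge0//.
by apply: (le_lt_trans h); rewrite ltry.
Qed.

End measure_comparison.

Section lipschitz.
Context {R : realType}.
Local Notation leb := (@lebesgue_measure R).
Implicit Types p q : {measure set (measurableTypeR R) -> \bar R}.

(** One step alone is not compactly supported; the difference of two is. Its derivative is a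
    difference of averaging kernels, so its pairing with f compares averages of f near x and near
    y. *)
Lemma test_function_step_difference (x x' y y' : R) (s1 k1 s2 k2 : R -> R) :
  x <= y -> x' <= y' -> smooth_step_between x x' s1 k1 -> smooth_step_between y y' s2 k2 ->
  test_function (fun t => s1 t - s2 t) /\
  ((fun t => s1 t - s2 t)^`())%classic = (fun t => k1 t - k2 t).
Proof.
move=> xy xy' [sm1 d1 _ l1 r1] [sm2 d2 _ l2 r2]; split.
  split.
    apply: differentiable_upto_derivable => n.
    have -> : (fun t => s1 t - s2 t) = (fun t => s1 t + -1 * s2 t).
      by apply/funext => t; rewrite mulN1r.
    apply: differentiable_uptoD => //; apply: differentiable_uptoM => //.
    exact: differentiable_upto_cst.
  exists (`|x| + `|y'|) => t; rewrite lter_normr => /orP[h|h].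
    have ty' : y' <= t.
      by rewrite ltW// (le_lt_trans _ h)// (le_trans (ler_norm _))// lerDr.
    have [-> _] := r1 _ (le_trans xy' ty').
    by have [-> _] := r2 _ ty'; rewrite subrr.
  have tx : t <= x.
    by have := ler_norm (- x); have := normr_ge0 y'; rewrite normrN; lra.
  have [-> _] := l1 _ tx.
  by have [-> _] := l2 _ (le_trans tx xy); rewrite subrr.
apply/funext => t; rewrite derive1E.
have [_ //] := is_deriveB (d1 t) (d2 t).
Qed.

(* Only one-sided neighbourhoods to the right of x and y are used: the smooth steps rise
   on [x, x + e] and [y, y + e], whence the room up to z. *)
Lemma lipschitz_of_distributional_derivative p q (f : R -> R) (x y z K B : R) :
  0 <= K -> x < y -> y < z -> measurable_fun setT f -> (forall t, `|f t| <= B) ->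
  {for x, continuous f} -> {for y, continuous f} ->
  (p `[x, z]%classic < +oo)%E -> (q `[x, z]%classic < +oo)%E ->
  (forall A : set (measurableTypeR R), measurable A -> A `<=` `[x, z]%classic ->
    (p A <= q A + K%:E * leb A)%E /\ (q A <= p A + K%:E * leb A)%E) ->
  (forall phi, test_function phi ->
    Rintegral p setT phi - Rintegral q setT phi =
      - Rintegral leb setT (fun t => phi^`()%classic t * f t)) ->
  `|f y - f x| <= K * (y - x).
Proof.
move=> K0 xy yz mf fB cx cy pfin qfin pq dd.
apply/ler_addgt0Pr => eta eta0.
have e30 : 0 < eta / 3 by rewrite divr_gt0.
(* The error eta is split in three: one third for each of the two averages, and one for K e, because
   the support [x, y + e] of the test function exceeds [x, y] by e. *)
have : \forall e \near (0 : R)^'+, 0 < e /\ x + e <= y /\ y + e <= z /\ K * e <= eta / 3 /\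
   (forall t, `|x - t| <= e -> `|f x - f t| <= eta / 3) /\
   (forall t, `|y - t| <= e -> `|f y - f t| <= eta / 3).
  have cont u : {for u, continuous f} -> \forall e \near (0 : R)^'+,
      forall t, `|u - t| <= e -> `|f u - f t| <= eta / 3.
    move=> /cvgrPdist_le /(_ _ e30) /nbhs_ballP[r /= r0 hr].
    near=> e => t ut; apply: hr => /=; apply: le_lt_trans ut _.
    by near: e; exact: nbhs_right_lt.
  near=> e; split; [|split; [|split; [|split; [|split]]]].
  - by [].
  - by rewrite -lerBrDl; near: e; apply: nbhs_right_le; rewrite subr_gt0.
  - by rewrite -lerBrDl; near: e; apply: nbhs_right_le; rewrite subr_gt0.
  - have : e <= eta / 3 / (K + 1).
      by near: e; apply: nbhs_right_le; rewrite divr_gt0// ltr_wpDl.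
    rewrite ler_pdivlMr ?ltr_wpDl// => /(le_trans _); apply.
    by rewrite mulrC ler_wpM2l// lerDl.
  - by near: e; exact: cont.
  - by near: e; exact: cont.
move=> /(@filter_ex _ _ (at_right_proper_filter (0 : R)))[e [e0 [xey [yez [Ke [hx hy]]]]]].
have [s1 [k1 sk1]] := @smooth_step_betweenP R x (x + e) ltac:(by rewrite ltrDl).
have [s2 [k2 sk2]] := @smooth_step_betweenP R y (y + e) ltac:(by rewrite ltrDl).
have xe : x < x + e by rewrite ltrDl.
have ye : y < y + e by rewrite ltrDl.
have [i1 a1] : leb.-integrable setT (EFin \o (fun t => k1 t * f t)) /\
    `|Rintegral leb setT (fun t => k1 t * f t) - f x| <= eta / 3.
  apply: (smooth_step_average xe sk1 mf fB) => t /andP[xt txe].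
  by rewrite distrC; apply: hx; rewrite distrC ger0_norm ?subr_ge0// lerBlDl.
have [i2 a2] : leb.-integrable setT (EFin \o (fun t => k2 t * f t)) /\
    `|Rintegral leb setT (fun t => k2 t * f t) - f y| <= eta / 3.
  apply: (smooth_step_average ye sk2 mf fB) => t /andP[xt txe].
  by rewrite distrC; apply: hy; rewrite distrC ger0_norm ?subr_ge0// lerBlDl.
have [tf dtf] := test_function_step_difference (ltW xy) (lerD (ltW xy) (lexx e)) sk1 sk2.
pose phi t := s1 t - s2 t.
have := dd _ tf; rewrite dtf.
have -> : Rintegral leb setT (fun t => (k1 t - k2 t) * f t) =
    Rintegral leb setT (fun t => k1 t * f t) - Rintegral leb setT (fun t => k2 t * f t).
  rewrite -RintegralB//; apply: eq_Rintegral => t _; exact: mulrBl.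
(* The first step is complete before the second begins, since x + e <= y; so at each t one of them
   is constant. *)
have phi01 t : 0 <= phi t <= 1.
  have /andP[p1 p2] := smooth_step_between_ge0le1 sk1 t.
  have /andP[p3 p4] := smooth_step_between_ge0le1 sk2 t.
  rewrite /phi; have [ty|ty] := leP t y.
    by case: sk2 => _ _ _ /(_ _ ty)[-> _] _; rewrite subr0 p1.
  case: sk1 => _ _ _ _ /(_ t)[]; first by rewrite (le_trans xey)// ltW.
  by move=> -> _; rewrite subr_ge0 p4 gerBl.
have phi0 t : ~ `[x, y + e]%classic t -> phi t = 0.
  rewrite /= in_itv/= => /negP; rewrite negb_and -!ltNge /phi => /orP[tx|ty].
    case: sk1 => _ _ _ /(_ _ (ltW tx))[-> _] _.
    by case: sk2 => _ _ _ /(_ _ (ltW (lt_trans tx xy)))[-> _] _; rewrite subrr.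
  case: sk2 => _ _ _ _ /(_ _ (ltW ty))[-> _].
  by case: sk1 => _ _ _ _ /(_ t)[|-> _]; rewrite ?subrr// (le_trans _ (ltW ty))// lerD2r ltW.
have mphi : measurable_fun setT phi.
  case: tf => /(_ 0%N) d _; apply: continuous_measurable_fun => t.
  by apply: differentiable_continuous; apply/derivable1_diffP; exact: d.
have sub : `[x, y + e]%classic `<=` `[x, z]%classic.
  by apply: subset_itvl; rewrite bnd_simp.
have fin (r : {measure set (measurableTypeR R) -> \bar R}) :
    (r `[x, z]%classic < +oo)%E -> (r `[x, (y + e)%R]%classic < +oo)%E.
  by apply: le_lt_trans; apply: le_measure => //; rewrite inE; exact: measurable_itv.
have xye : x <= y + e by rewrite ltW// (lt_trans xy).
have b1 := le_Rintegral_of_measure_bound K0 xye (fin _ qfin)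
  (fun A mA As => (pq A mA (subset_trans As sub)).1) mphi phi01 phi0.
have b2 := le_Rintegral_of_measure_bound K0 xye (fin _ pfin)
  (fun A mA As => (pq A mA (subset_trans As sub)).2) mphi phi01 phi0.
move: b1 b2 a1 a2; rewrite /phi !ler_norml.
have -> : y + e - x = (y - x) + e by ring.
rewrite mulrDr.
move: (Rintegral p _ _) (Rintegral q _ _) (Rintegral leb _ _) (Rintegral leb _ _) => P Q L1 L2.
move: (K * e) (K * (y - x)) Ke => Ke Kyx hKe b1 b2 /andP[a1 a1'] /andP[a2 a2'] h.
by apply/andP; split; lra.
Unshelve. all: by end_near. Qed.

End lipschitz.

(** * Exponential weights with polynomial factors *)

Section weight.
Context {R : realType}.
Implicit Types (m t x : R).

Lemma powR1D_le_expR m (e : R) : 0 <= m -> 0 < e ->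
  exists2 C, 0 < C & forall s, 0 <= s -> (1 + s) `^ m <= C * expR (e * s).
Proof.
(* Since ln (1 + s) <= ln c + (1 + s) / c, this [c] gives the slope m / c <= e; adding 1 to m keeps
   it positive when m = 0. *)
move=> m0 e0; pose c := (m + 1) / e.
have c0 : 0 < c by rewrite divr_gt0// ltr_wpDl.
exists (expR (m * ln c + e)) => [|s s0]; first exact: expR_gt0.
have s1 : 0 < 1 + s by rewrite ltr_pwDl.
rewrite /powR gt_eqF// -expRD ler_expR.
have : ln (1 + s) <= ln c + (1 + s) / c.
  have h : 0 < (1 + s) / c by rewrite divr_gt0.
  rewrite [in leLHS](_ : 1 + s = c * ((1 + s) / c)); last by rewrite mulrC divfK ?gt_eqF.
  by rewrite lnM ?posrE// lerD2l ltW// ln_sublinear.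
move=> /(ler_wpM2l m0) /le_trans; apply.
have mc : m / c <= e.
  by rewrite ler_pdivrMr// /c mulrCA divff ?gt_eqF// mulr1 lerDl.
have -> : m * (ln c + (1 + s) / c) = m * ln c + m / c * (1 + s) by ring.
by have := ler_wpM2r (ltW s1) mc; lra.
Qed.

Lemma weight_ge0 m t : 0 <= weight m t.
Proof. by rewrite /weight mulr_ge0 ?powR_ge0 ?expR_ge0. Qed.

Lemma powR_1D_triangle m x y : 0 <= m ->
  (1 + `|x + y|) `^ m <= (1 + `|x|) `^ m * (1 + `|y|) `^ m.
Proof.
move=> m0; rewrite -powRM ?addr_ge0//; apply: ge0_ler_powR => //; rewrite ?nnegrE ?addr_ge0//.
by have := ler_normD x y; have := normr_ge0 x; have := normr_ge0 y; nra.
Qed.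

(** Submultiplicativity of 1 + |t| treats the power and the triangle inequality the exponential.
    Bounds on a short interval can thus be referred to one of its points. *)
Lemma weight_near m d x t : 0 <= m -> `|t - x| <= d ->
  weight m t <= (1 + d) `^ m * expR (d / 2) * weight m x.
Proof.
move=> m0 td; have d0 : 0 <= d by exact: le_trans td.
rewrite /weight mulrACA; apply: ler_pM; rewrite ?powR_ge0 ?expR_ge0//.
  rewrite -[t in leLHS](subrK x); apply: (le_trans (powR_1D_triangle _ _ m0)).
  rewrite ler_wpM2r ?powR_ge0//; apply: ge0_ler_powR => //; rewrite ?nnegrE ?addr_ge0//.
  by rewrite lerD2l.
rewrite -expRD ler_expR.
have := ler_normD (x - t) t; rewrite subrK distrC; move: td.
move: `|x| `|t| `|t - x| => a b c; lra.
Qed.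

Lemma weight_bounded m : 0 <= m -> exists C, forall t, weight m t <= C.
Proof.
move=> m0; have [C C0 hC] := powR1D_le_expR m0 (ltac:(lra) : (0 : R) < 1 / 2).
exists C => t; rewrite /weight -ler_pdivlMr ?expR_gt0// -expRN.
have -> : - (- `|t| / 2) = 1 / 2 * `|t| by field.
exact: hC.
Qed.

Lemma measurable_weight m : measurable_fun setT (@weight R m).
Proof.
apply: measurable_funM.
- apply: (@measurableT_comp _ _ _ _ _ _ (fun x => x `^ m)); first exact: measurable_powR.
  by apply: measurable_funD => //; exact: measurableT_comp.
- apply: measurableT_comp => //; apply: measurable_funM => //.
  by apply: measurableT_comp => //; exact: measurableT_comp.
Qed.

End weight.

Section normc.
Context {R : realType}.
Implicit Types z w : R[i].

Lemma normc_ge0 z : 0 <= normc z.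
Proof. by case: z => x y; exact: sqrtr_ge0. Qed.

Lemma normcM z w : normc (z * w) = normc z * normc w.
Proof. exact: ComplexField.Normc.normcM. Qed.

Lemma normcD z w : normc (z + w) <= normc z + normc w.
Proof. exact: (@ler_normD _ (Rcomplex R)). Qed.

Lemma normcN z : normc (- z) = normc z.
Proof. exact: (@normrN _ (Rcomplex R)). Qed.

Lemma normcB z w : normc (z - w) = normc (w - z).
Proof. by rewrite -normcN opprB. Qed.

Lemma normc_real (x : R) : normc x%:C%C = `|x|.
Proof. by rewrite /= expr0n addr0 sqrtr_sqr. Qed.

Lemma normr_Re_le z : `|complex.Re z| <= normc z.
Proof. by case: z => x y /=; rewrite -sqrtr_sqr ler_wsqrtr// lerDl sqr_ge0. Qed.

Lemma normr_Im_le z : `|complex.Im z| <= normc z.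
Proof. by case: z => x y /=; rewrite -sqrtr_sqr ler_wsqrtr// lerDr sqr_ge0. Qed.

Lemma normc_le_ReIm z : normc z <= `|complex.Re z| + `|complex.Im z|.
Proof.
case: z => x y /=; rewrite -[leRHS]ger0_norm ?addr_ge0// -[leRHS]sqrtr_sqr ler_wsqrtr//.
by rewrite sqrrD !real_normK ?num_real//; have := normr_ge0 x; have := normr_ge0 y; nra.
Qed.

Lemma ReM_real (r : R) z : complex.Re (r%:C%C * z) = r * complex.Re z.
Proof. by case: z => x y /=; rewrite mul0r subr0. Qed.

Lemma ImM_real (r : R) z : complex.Im (r%:C%C * z) = r * complex.Im z.
Proof. by case: z => x y /=; rewrite mul0r addr0. Qed.

Lemma ReM z w :
  complex.Re (z * w) = complex.Re z * complex.Re w - complex.Im z * complex.Im w.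
Proof. by case: z; case: w. Qed.

Lemma ImM z w :
  complex.Im (z * w) = complex.Re z * complex.Im w + complex.Im z * complex.Re w.
Proof. by case: z; case: w. Qed.

Lemma ReB z w : complex.Re (z - w) = complex.Re z - complex.Re w.
Proof. by case: z; case: w. Qed.

Lemma ImB z w : complex.Im (z - w) = complex.Im z - complex.Im w.
Proof. by case: z; case: w. Qed.

Lemma continuous_of_normc (f : R -> R[i]) (g : R -> R) (t : R) :
  (forall u v, `|g u - g v| <= normc (f u - f v)) ->
  {for t, continuous f} -> {for t, continuous g}.
Proof.
move=> gf /cvgrPdist_le cf; apply/cvgrPdist_le => e e0.
have e0' : (0 : R[i]) < e%:C%C by rewrite ltcR.
have := cf _ e0'; apply: filterS => u h.
by apply: (le_trans (gf _ _)); rewrite -lecR.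
Qed.

End normc.

(** * Functions continuous off a finite set *)

Section regularity.
Context {R : realType}.

(** Off the finite set, which has open complement, continuity suffices; on it every preimage is
    finite, hence closed. *)
Lemma measurable_fun_continuous_off_finite (s : seq R) (f : R -> R) :
  (forall t, t \notin s -> {for t, continuous f}) -> measurable_fun setT f.
Proof.
move=> cf; pose J : set R := [set` s].
have finJ : finite_set J by exact: finite_seq.
have closed_fin : forall A : set R, finite_set A -> closed A.
  by apply/accessible_finite_set_closed/hausdorff_accessible; exact: Rhausdorff.
have clJ : closed J by exact: closed_fin.
have -> : [set: R] = ~` J `|` J by rewrite setUC setUv.
have mJ : measurable J by exact: closed_measurable.
apply/measurable_funU => //; first exact: measurableC.
split.
  apply: open_continuous_measurable_fun; first exact: closed_openC.
  by move=> t; rewrite inE /J /= => /negP ts; exact: cf.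
move=> _ B mB; apply: closed_measurable; apply: closed_fin.
by apply: sub_finite_set finJ; exact: subIsetl.
Qed.

(** Provides the room beyond y in which the second smooth step can rise without meeting another
    jump. *)
Lemma exists_gap_right (s : seq R) (y e : R) : 0 < e ->
  exists2 z, y < z <= y + e & forall t, t \in s -> y < t -> z < t.
Proof.
move=> e0; elim: s => [|t s [z /andP[yz ze] hz]].
  by exists (y + e); rewrite ?ltrDl ?e0 ?lexx.
have [yt|ty] := ltP y t; last first.
  exists z; rewrite ?yz// => u; rewrite inE => /orP[/eqP ->|]; first by rewrite ltNge ty.
  exact: hz.
exists (Order.min z ((y + t) / 2)).
  by rewrite lt_min yz ge_min ze andbT; apply/andP; split=> //; lra.
move=> u; rewrite inE => /orP[/eqP -> _|us yu].
  by rewrite gt_min; apply/orP; right; lra.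
by rewrite gt_min hz.
Qed.

End regularity.

(** * Lipschitz bounds for profiles between jumps *)

Section FBV_regular.
Context {R : realType}.
Local Notation leb := (@lebesgue_measure R).
Implicit Types (D : cradon R) (A : set (measurableTypeR R)).

Lemma cradon_val_le_variation D A : measurable A -> bounded_set (A : set R) ->
  ((normc (cradon_val D A))%:E <= cradon_variation D A)%E.
Proof.
move=> mA bA; apply: ereal_sup_ubound.
exists 1%N, (fun i => if i == 0%N then A else set0); split.
- move=> i; case: ifPn => _; split=> //; split=> //.
  by exists 0; split => // x _ y [].
- move=> i j _ _; case: ifPn => [/eqP ->|_]; case: ifPn => [/eqP ->|_] //.
  + by move=> [x []].
  + by move=> [x []].
  + by move=> [x []].
- by rewrite big_ord1.
Qed.

Lemma fine_bound (p q : {measure set (measurableTypeR R) -> \bar R}) A (K : R) :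
  (p A < +oo)%E -> (q A < +oo)%E -> (leb A < +oo)%E ->
  (`|fine (p A) - fine (q A)|%:E <= K%:E * leb A)%E ->
  (p A <= q A + K%:E * leb A)%E /\ (q A <= p A + K%:E * leb A)%E.
Proof.
move=> pfin qfin lfin.
have pf : p A \is a fin_num by rewrite ge0_fin_numE ?measure_ge0.
have qf : q A \is a fin_num by rewrite ge0_fin_numE ?measure_ge0.
have lf : leb A \is a fin_num by rewrite ge0_fin_numE ?measure_ge0.
rewrite -(fineK pf) -(fineK qf) -(fineK lf) -EFinM -!EFinD !lee_fin ler_norml /=.
by move=> /andP[h1 h2]; split; lra.
Qed.

Lemma dirac_sum_eq0 (J : seq R) (c : R -> \bar R) A :
  (forall t, t \in J -> ~ A t) -> (\sum_(tau <- J) c tau * \d_tau A)%E = 0%E.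
Proof.
move=> JA; rewrite big_seq big1// => t tJ.
by rewrite diracE memNset ?mule0//; exact: JA.
Qed.

(** On an interval that misses J the measure bound reduces to one by a multiple of Lebesgue measure,
    and this is a Lipschitz bound for the real and imaginary parts. *)
Lemma FBV_regular m kappa : 0 <= m -> @FBV R m kappa ->
  exists (K : R) (J : seq R),
  [/\ 0 < K,
      forall t, normc (profile kappa t) <= K * weight m t,
      measurable_fun setT (fun t => complex.Re (profile kappa t)),
      measurable_fun setT (fun t => complex.Im (profile kappa t))
    & forall x y, `|y - x| <= 1 ->
        (forall t, t \in J -> ~~ (Order.min x y <= t <= Order.max x y)) ->
        normc (profile kappa y - profile kappa x) <= K * weight m x * `|y - x|].
Proof.
move=> m0 [_ [K [J [D [K0 cf bf dd var]]]]].
set f := profile kappa in cf bf dd var *.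
(* Radius 2 because the interval [x, z] below has length at most 2: y - x <= 1 and z - y <= 1. *)
have [C C1 wC] : exists2 C : R, 1 <= C &
    forall x t, `|t - x| <= 2 -> weight m t <= C * weight m x.
  exists ((1 + 2) `^ m * expR (2 / 2)) => [|x t]; last exact: weight_near.
  apply: mulr_ege1; last by rewrite -[leLHS]expR0 ler_expR divr_ge0.
  by rewrite -[leLHS](powRr0 (1 + 2)) ler_powR//; lra.
have C0 : 0 < C by exact: lt_le_trans C1.
have [Bw hBw] := weight_bounded m0 (R := R).
have cRe t : t \notin (J : seq R) -> {for t, continuous (fun t => complex.Re (f t))}.
  move=> /cf; apply: continuous_of_normc => u v; rewrite -ReB; exact: normr_Re_le.
have cIm t : t \notin (J : seq R) -> {for t, continuous (fun t => complex.Im (f t))}.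
  move=> /cf; apply: continuous_of_normc => u v; rewrite -ImB; exact: normr_Im_le.
have mRe := measurable_fun_continuous_off_finite cRe.
have mIm := measurable_fun_continuous_off_finite cIm.
have bRe t : `|complex.Re (f t)| <= K * Bw.
  by rewrite (le_trans (normr_Re_le _))// (le_trans (bf _))// ler_wpM2l// ltW.
have bIm t : `|complex.Im (f t)| <= K * Bw.
  by rewrite (le_trans (normr_Im_le _))// (le_trans (bf _))// ler_wpM2l// ltW.
have ddRe phi : test_function phi ->
    Rintegral (re_pos D) setT phi - Rintegral (re_neg D) setT phi =
    - Rintegral leb setT (fun t => phi^`()%classic t * complex.Re (f t)).
  move=> /dd /(congr1 (@complex.Re R)) /= ->; congr (- _).
  by apply: eq_Rintegral => t _; rewrite ReM_real.
have ddIm phi : test_function phi ->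
    Rintegral (im_pos D) setT phi - Rintegral (im_neg D) setT phi =
    - Rintegral leb setT (fun t => phi^`()%classic t * complex.Im (f t)).
  move=> /dd /(congr1 (@complex.Im R)) /= ->; congr (- _).
  by apply: eq_Rintegral => t _; rewrite ImM_real.
have core x y : x < y -> y - x <= 1 ->
    (forall t, t \in (J : seq R) -> ~~ (x <= t <= y)) ->
    normc (f y - f x) <= 2 * (K * (C * weight m x)) * (y - x).
  move=> xy xy1 Jxy.
  have [z /andP[yz zy1] hz] := @exists_gap_right R J y 1 ltr01.
  have Jz t : t \in (J : seq R) -> ~ `[x, z]%classic t.
    move=> tJ; rewrite /= in_itv/= => /andP[xt tz].
    have := Jxy _ tJ; rewrite xt/= -ltNge => /(hz _ tJ).
    by rewrite ltNge tz.
  pose L := K * (C * weight m x).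
  have L0 : 0 <= L by rewrite !mulr_ge0 ?weight_ge0// ltW.
  have mI : measurable (`[x, z]%classic : set (measurableTypeR R)) by exact: measurable_itv.
  have small A (r : {measure set (measurableTypeR R) -> \bar R}) :
      measurable A -> A `<=` `[x, z]%classic -> (r `[x, z]%classic < +oo)%E -> (r A < +oo)%E.
    by move=> mA Axz; apply: le_lt_trans; apply: le_measure => //; rewrite inE.
  have lebz : (leb `[x, z]%classic < +oo)%E.
    by rewrite lebesgue_measure_itv/=; case: ifP => _; rewrite ltry.
  have main A : measurable A -> A `<=` `[x, z]%classic ->
      ((normc (cradon_val D A))%:E <= L%:E * leb A)%E.
    move=> mA Axz.
    have bA : bounded_set (A : set R).
      have bI : bounded_set (`[x, z]%classic : set R).
        by apply: compact_bounded; exact: segment_compact.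
      case: bI => M [Mr hM]; exists M; split => // N /hM h u /Axz; exact: h.
    have AJ t : t \in (J : seq R) -> ~ A t by move=> tJ /Axz; exact: Jz.
    apply: (le_trans (cradon_val_le_variation D mA bA)).
    (* A contains no point of J, so the Dirac sums vanish on both sides and only the density is
       left. *)
    have := var A mA; rewrite dirac_sum_eq0// adde0 dirac_sum_eq0// adde0 => /le_trans; apply.
    rewrite /L EFinM -muleA lee_pmul2l//.
    rewrite -integral_cst//; apply: ge0_le_integral => //.
    - by move=> t _; rewrite lee_fin weight_ge0.
    - apply/measurable_EFinP; exact: (measurable_funS measurableT _ (measurable_weight m)).
    - move=> t /Axz; rewrite /= in_itv/= => /andP[xt tz].
      rewrite lee_fin; apply: wC.
      by rewrite ger0_norm ?subr_ge0//; lra.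
  have comp (p q : {measure set (measurableTypeR R) -> \bar R}) (g : R -> R) :
      locally_finite p -> locally_finite q ->
      (forall A, `|fine (p A) - fine (q A)| <= normc (cradon_val D A)) ->
      measurable_fun setT g -> (forall t, `|g t| <= K * Bw) ->
      (forall t, t \notin (J : seq R) -> {for t, continuous g}) ->
      (forall phi, test_function phi ->
        Rintegral p setT phi - Rintegral q setT phi =
        - Rintegral leb setT (fun t => phi^`()%classic t * g t)) ->
      `|g y - g x| <= L * (y - x).
    move=> lp lq pqD mg bg cg ddg.
    apply: (lipschitz_of_distributional_derivative L0 xy yz mg bg _ _ (lp _ _) (lq _ _) _ ddg).
    - by apply: cg; apply/negP => /Jxy; rewrite lexx ltW.
    - by apply: cg; apply/negP => /Jxy; rewrite lexx ltW.
    - move=> A mA Axz; apply: fine_bound; try exact: small.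
      by apply: le_trans (main A mA Axz); rewrite lee_fin.
  apply: (le_trans (normc_le_ReIm _)); rewrite ReB ImB.
  rewrite (_ : 2 * _ * _ = L * (y - x) + L * (y - x)); last by rewrite /L; ring.
  apply: lerD.
    apply: (comp (re_pos D) (re_neg D) (fun t => complex.Re (f t)) _ _ _ mRe bRe cRe ddRe).
    - exact: re_posP.
    - exact: re_negP.
    - by move=> A; exact: (normr_Re_le (cradon_val D A)).
  apply: (comp (im_pos D) (im_neg D) (fun t => complex.Im (f t)) _ _ _ mIm bIm cIm ddIm).
  - exact: im_posP.
  - exact: im_negP.
  - by move=> A; exact: (normr_Im_le (cradon_val D A)).
have CC : C <= C ^+ 2 by rewrite expr2 ler_peMr// ltW.
(* The 2 adds real and imaginary parts. One C compares the weight on [x, z] with its value at the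
   left end; the other is for y < x, where that end is y and the weight must be moved to x. *)
exists (2 * (K * C ^+ 2)), J; split => //.
- by rewrite !mulr_gt0// exprn_gt0.
- move=> t; apply: (le_trans (bf t)); rewrite ler_wpM2r ?weight_ge0//.
  have : K * 1 <= K * C ^+ 2 
    by apply: (ler_wpM2l (ltW K0)); exact: le_trans CC.
  by rewrite mulr1; lra.
- move=> x y; have [xy|xy|<-] := ltgtP x y.
  + have xy0 : 0 <= y - x by rewrite subr_ge0 ltW.
    rewrite (ger0_norm xy0) => xy1 Jxy; apply: (le_trans (core _ _ xy xy1 Jxy)).
    rewrite (ler_wpM2r xy0)// -!mulrA ler_wpM2l// (ler_wpM2l (ltW K0))//.
    by rewrite mulrA (ler_wpM2r (weight_ge0 m x)).
  + have xy0 : 0 <= x - y by rewrite subr_ge0 ltW.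
    rewrite distrC (ger0_norm xy0) => xy1 Jxy; rewrite normcB.
    apply: (le_trans (core _ _ xy xy1 Jxy)).
    rewrite (ler_wpM2r xy0)// -!mulrA ler_wpM2l// (ler_wpM2l (ltW K0))//.
    rewrite (ler_wpM2l (ltW C0))//; apply: wC.
    by rewrite distrC (ger0_norm xy0); lra.
  + by rewrite !subrr normr0 mulr0 ComplexField.Normc.normc0.
Qed.

End FBV_regular.

(** * Schur's test and operators on the Hardy space *)

Section schur.
Context {R : realType}.
Implicit Types (j k n N : nat).

(** Quarter powers are chosen since n^{1/4} and n^{-1/4} telescope: their increments bound n^{-3/4}
    and n^{-5/4}, the powers met in Schur's test. *)
Definition root4 n : R := Num.sqrt (Num.sqrt n%:R).

Lemma root4_ge0 n : 0 <= root4 n. Proof. exact: sqrtr_ge0. Qed.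

Lemma root4_gt0 n : 0 < root4 n.+1.
Proof. by rewrite /root4 !sqrtr_gt0 ltr0n. Qed.

Lemma root4X n : root4 n ^+ 4 = n%:R.
Proof. by rewrite (exprM _ 2 2) !sqr_sqrtr// sqrtr_ge0. Qed.

Lemma root4_0 : root4 0 = 0. Proof. by rewrite /root4 !sqrtr0. Qed.

Lemma ler_root4 n N : (n <= N)%N -> root4 n <= root4 N.
Proof. by move=> nN; rewrite /root4 !ler_wsqrtr// ler_nat. Qed.

Lemma root4_ge1 n : 1 <= root4 n.+1.
Proof. by rewrite -[1](_ : root4 1 = 1) ?ler_root4// /root4 !sqrtr1. Qed.

(** Discrete form of (4 x^{1/4})' = x^{-3/4}. With a >= b the two roots, 1 = a^4 - b^4 = (a - b)(a^3
    + a^2 b + a b^2 + b^3) <= 4 (a - b) a^3. *)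
Lemma root4_step n : (root4 n.+1 ^+ 3)^-1 <= 4 * (root4 n.+1 - root4 n).
Proof.
have a0 := root4_gt0 n; have b0 := root4_ge0 n.
have ab : root4 n <= root4 n.+1 by exact: ler_root4.
have h : root4 n.+1 ^+ 4 - root4 n ^+ 4 = 1 by rewrite !root4X -natrB// subSnn.
rewrite -[leLHS]div1r ler_pdivrMr ?exprn_gt0// -[leLHS]h.
have hp : root4 n.+1 ^+ 3 + root4 n.+1 ^+ 2 * root4 n + root4 n.+1 * root4 n ^+ 2
    + root4 n ^+ 3 <= 4 * root4 n.+1 ^+ 3.
  move: (root4 n.+1) (root4 n) a0 b0 ab {h} => a b a0 b0 ab.
  have h1 : b ^+ 2 <= a ^+ 2 by rewrite ler_sqr ?nnegrE// ltW.
  have h2 : a ^+ 2 * b <= a ^+ 2 * a by rewrite ler_wpM2l ?sqr_ge0.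
  have h3 : a * b ^+ 2 <= a * a ^+ 2 by rewrite ler_wpM2l// ltW.
  have h4 : b * b ^+ 2 <= a * a ^+ 2 by rewrite ler_pM ?sqr_ge0.
  by rewrite !exprS !expr0 in h1 h2 h3 h4 *; lra.
rewrite [leLHS](_ : _ = (root4 n.+1 - root4 n) * (root4 n.+1 ^+ 3 + root4 n.+1 ^+ 2 * root4 n
  + root4 n.+1 * root4 n ^+ 2 + root4 n ^+ 3)); last by ring.
rewrite [leRHS](_ : _ = (root4 n.+1 - root4 n) * (4 * root4 n.+1 ^+ 3)); last by ring.
by rewrite ler_wpM2l// subr_ge0.
Qed.

(** The analogue for x^{-5/4}: divide [root4_step] by the product of the two roots and replace the
    smaller root by the larger. The index starts one later to keep the smaller root positive. *)
Lemma root4_step_inv n :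
  (root4 n.+2 ^+ 5)^-1 <= 4 * ((root4 n.+1)^-1 - (root4 n.+2)^-1).
Proof.
have a0 := root4_gt0 n.+1; have b0 := root4_gt0 n.
have ab : root4 n.+1 <= root4 n.+2 by exact: ler_root4.
have := root4_step n.+1.
rewrite (_ : _^-1 - _^-1 = (root4 n.+2 - root4 n.+1) / (root4 n.+1 * root4 n.+2)); last first.
  by field; rewrite !gt_eqF.
move=> h; rewrite mulrA ler_pdivlMr ?mulr_gt0//; apply: le_trans h.
rewrite ler_pdivrMl ?exprn_gt0// ler_pdivlMr ?exprn_gt0//.
move: (root4 n.+2) (root4 n.+1) a0 b0 ab => a b a0 b0 ab.
rewrite (_ : b * a * a ^+ 3 = b * a ^+ 4); last by ring.
by rewrite [leRHS]exprS ler_wpM2r// exprn_ge0// ltW.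
Qed.

(* The kernel 1 / (a^{3/4} b^{1/4}), a >= b, is bounded on l^2 by Schur's test with
   weights a^{-1/2}, and dominates every kernel polylog(a / b) / max(a, b). *)
Definition schur_kernel j k : R :=
  if (k <= j)%N then (root4 j.+1 ^+ 3 * root4 k.+1)^-1
  else (root4 k.+1 ^+ 3 * root4 j.+1)^-1.

Lemma schur_kernel_ge0 j k : 0 <= schur_kernel j k.
Proof.
by rewrite /schur_kernel; case: ifP => _; rewrite invr_ge0 mulr_ge0 ?exprn_ge0 ?root4_ge0.
Qed.

Lemma schur_kernelC j k : schur_kernel j k = schur_kernel k j.
Proof.
rewrite /schur_kernel; by case: (ltngtP j k) => // ->.
Qed.

(** With a = j + 1 and c = k + 1, the terms are a^{-3/4} c^{-3/4} for c <= a and a^{-1/4} c^{-5/4}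
    for c > a. Each range telescopes to at most 4 a^{-1/2}. *)
Lemma schur_kernel_test j N :
  \sum_(k < N) schur_kernel j k * (root4 k.+1 ^+ 2)^-1 <= 8 * (root4 j.+1 ^+ 2)^-1.
Proof.
pose S N := \sum_(k < N) schur_kernel j k * (root4 k.+1 ^+ 2)^-1.
have r0 := root4_gt0 j.
have S1 M : (M <= j.+1)%N -> S M <= 4 * root4 M / root4 j.+1 ^+ 3.
  elim: M => [_|M IH Mj]; first by rewrite /S big_ord0 root4_0 mulr0 mul0r.
  rewrite /S big_ord_recr /=.
  apply: (le_trans (lerD (IH (ltnW Mj)) (lexx _))).
  rewrite {1}/schur_kernel -ltnS Mj.
  have -> : (root4 j.+1 ^+ 3 * root4 M.+1)^-1 / root4 M.+1 ^+ 2 =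
      (root4 M.+1 ^+ 3)^-1 / root4 j.+1 ^+ 3.
    by have := root4_gt0 M => h; field; rewrite !gt_eqF.
  rewrite -mulrDl ler_wpM2r ?invr_ge0 ?exprn_ge0 ?(ltW r0)//.
  by have := root4_step M; lra.
have S2 d : S (j.+1 + d)%N <= 8 / root4 j.+1 ^+ 2 - 4 / (root4 j.+1 * root4 (j.+1 + d)%N).
  elim: d => [|d IH].
    rewrite addn0; apply: (le_trans (S1 _ (leqnn _))).
    rewrite le_eqVlt; apply/orP; left; apply/eqP; field; by rewrite gt_eqF.
  rewrite addnS /S big_ord_recr /=.
  apply: (le_trans (lerD IH (lexx _))).
  have q0 := root4_gt0 (j.+1 + d); have q0' := root4_gt0 (j + d).
  rewrite {1}/schur_kernel leqNgt ltn_addr ?ltnSn//=.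
  have := root4_step_inv (j + d); rewrite -addSn.
  have -> : (root4 (j.+1 + d).+1 ^+ 3 * root4 j.+1)^-1 / root4 (j.+1 + d).+1 ^+ 2 =
      (root4 (j.+1 + d).+1 ^+ 5)^-1 / root4 j.+1.
    by field; rewrite !gt_eqF.
  rewrite -!addSn in q0 q0' *.
  move: (root4 j.+1) (root4 (j.+1 + d)%N) (root4 (j.+1 + d).+1) r0 q0 q0' => a b c a0 c0 b0.
  move=> h; have : (c ^+ 5)^-1 / a <= 4 * (b^-1 - c^-1) / a by rewrite ler_wpM2r// invr_ge0 ltW.
  have -> : 4 * (b^-1 - c^-1) / a = 4 / (a * b) - 4 / (a * c) by field; rewrite !gt_eqF.
  lra.
have [Nj|jN] := leqP N j.+1.
  apply: (le_trans (S1 _ Nj)).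
  have h : root4 N <= root4 j.+1 by exact: ler_root4.
  rewrite ler_pdivlMr ?exprn_gt0//.
  have -> : 4 * root4 N / root4 j.+1 ^+ 3 * root4 j.+1 ^+ 2 = 4 * (root4 N / root4 j.+1).
    by field; rewrite gt_eqF.
  have : root4 N / root4 j.+1 <= 1 by rewrite ler_pdivrMr// mul1r.
  lra.
rewrite -(subnKC (ltnW jN)); apply: (le_trans (S2 _)).
by rewrite gerBl divr_ge0// mulr_ge0 ?root4_ge0.
Qed.

(** Schur's test on finite sections: weighted Cauchy-Schwarz in each row costs a factor 8, and the
    sum over the rows, by symmetry of the kernel, another 8. *)
Lemma schur_bound (x : nat -> R) N M :
  \sum_(j < N) (\sum_(k < M) schur_kernel j k * x k) ^+ 2 <= 64 * \sum_(k < M) x k ^+ 2.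
Proof.
pose p k : R := (root4 k.+1 ^+ 2)^-1.
have p0 k : 0 < p k by rewrite invr_gt0 exprn_gt0// root4_gt0.
pose s := schur_kernel.
have s0 j k : 0 <= s j k by exact: schur_kernel_ge0.
have q0 k : 0 <= x k ^+ 2 / p k by rewrite divr_ge0 ?sqr_ge0// ltW.
have row j : (\sum_(k < M) s j k * x k) ^+ 2 <= 8 * p j * \sum_(k < M) s j k * (x k ^+ 2 / p k).
  rewrite expr2 big_distrl /=.
  have -> : \sum_(i < M) s j i * x i * (\sum_(k < M) s j k * x k) =
      \sum_(i < M) \sum_(k < M) s j i * s j k * (x i * x k).
    by apply: eq_bigr => i _; rewrite big_distrr /=; apply: eq_bigr => k _; ring.
  (* Cauchy-Schwarz is obtained by applying to each term of the expanded square the inequality of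
     arithmetic and geometric means with weights [p]; the two halves of the mean have equal sums by
     exchanging i and k. *)
  have amgm : \sum_(i < M) \sum_(k < M) s j i * s j k * (x i * x k) <=
      \sum_(i < M) \sum_(k < M) s j i * s j k * ((x i ^+ 2 * p k / p i + x k ^+ 2 * p i / p k) / 2).
    apply: ler_sum => i _; apply: ler_sum => k _; apply: ler_wpM2l; first by rewrite mulr_ge0.
    have pi := p0 i; have pk := p0 k.
    rewrite -subr_ge0.
    have -> : (x i ^+ 2 * p k / p i + x k ^+ 2 * p i / p k) / 2 - x i * x k =
      (x i * p k - x k * p i) ^+ 2 / (2 * (p i * p k)) by field; rewrite !gt_eqF.
    by rewrite divr_ge0 ?sqr_ge0// mulr_ge0// mulr_ge0 ?ltW.
  apply: (le_trans amgm).
  have sym : \sum_(i < M) \sum_(k < M)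
        s j i * s j k * ((x i ^+ 2 * p k / p i + x k ^+ 2 * p i / p k) / 2) =
      \sum_(i < M) \sum_(k < M) s j i * s j k * (x i ^+ 2 * p k / p i).
    pose A (i k : 'I_M) := s j i * s j k * (x i ^+ 2 * p k / p i) / 2.
    transitivity (\sum_(i < M) \sum_(k < M) (A i k + A k i)).
      by apply: eq_bigr => i _; apply: eq_bigr => k _; rewrite /A; ring.
    under eq_bigr do rewrite big_split /=.
    rewrite big_split /= [X in _ + X]exchange_big /= -big_split /=.
    apply: eq_bigr => i _; rewrite -big_split /=; apply: eq_bigr => k _; rewrite /A.
    by field; rewrite gt_eqF.
  rewrite sym big_distrr /=; apply: ler_sum => i _.
  have -> : \sum_(k < M) s j i * s j k * (x i ^+ 2 * p k / p i) =
      (s j i * (x i ^+ 2 / p i)) * \sum_(k < M) s j k * p k.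
    by rewrite big_distrr /=; apply: eq_bigr => k _; ring.
  rewrite [leRHS]mulrC; apply: ler_wpM2l; first exact: mulr_ge0 (s0 _ _) (q0 _).
  exact: schur_kernel_test.
apply: (@le_trans _ _ (\sum_(j < N) 8 * p j * (\sum_(k < M) s j k * (x k ^+ 2 / p k)))).
  by apply: ler_sum => j _; exact: row.
have -> : \sum_(j < N) 8 * p j * (\sum_(k < M) s j k * (x k ^+ 2 / p k)) =
    \sum_(k < M) 8 * (x k ^+ 2 / p k) * \sum_(j < N) s k j * p j.
  under eq_bigr do rewrite big_distrr /=.
  rewrite exchange_big /=; apply: eq_bigr => k _; rewrite big_distrr /=.
  by apply: eq_bigr => j _; rewrite /s (schur_kernelC k j); ring.
rewrite big_distrr /=; apply: ler_sum => k _.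
have -> : 64 * x k ^+ 2 = 8 * (x k ^+ 2 / p k) * (8 * p k).
  by field; rewrite gt_eqF.
apply: ler_wpM2l; last exact: schur_kernel_test.
by rewrite mulr_ge0 ?q0.
Qed.

(** The terms n^{-3/2} are at most n^{-5/4}, which telescopes: the first term is 1 and the others
    add up to at most 4. *)
Lemma sum_root4_inv6 N : \sum_(k < N) (root4 k.+1 ^+ 6)^-1 <= 5.
Proof.
suff h n : \sum_(k < n.+1) (root4 k.+1 ^+ 6)^-1 <= 5 - 4 / root4 n.+1.
  case: N => [|N]; first by rewrite big_ord0.
  by apply: (le_trans (h _)); rewrite gerBl divr_ge0// root4_ge0.
elim: n => [|n IH].
  by rewrite big_ord1 /root4 !sqrtr1 expr1n; lra.
rewrite big_ord_recr /=; apply: (le_trans (lerD IH (lexx _))).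
have := root4_step_inv n.
have : (root4 n.+2 ^+ 6)^-1 <= (root4 n.+2 ^+ 5)^-1.
  rewrite lef_pV2 ?posrE ?exprn_gt0 ?root4_gt0//.
  by rewrite [leRHS]exprS ler_peMl ?exprn_ge0 ?root4_ge0// root4_ge1.
lra.
Qed.

End schur.

(** * Complex series by real and imaginary parts *)

Section complex_series.
Context {R : realType}.
Implicit Types (u v : nat -> R[i]) (a b c : R[i]).

Definition csum u : R[i] :=
  (limn (series (fun k => complex.Re (u k))) +i* limn (series (fun k => complex.Im (u k))))%C.

(** Convergence is stated separately because [csum] has a value even for a divergent series. *)
Definition has_csum u a :=
  series (fun k => complex.Re (u k)) @ \oo --> complex.Re a /\
  series (fun k => complex.Im (u k)) @ \oo --> complex.Im a.

Lemma has_csum_csum u a : has_csum u a -> csum u = a.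
Proof. by case: a => x y [/= h1 h2]; rewrite /csum; congr (_ +i* _)%C; apply/cvg_lim. Qed.

Lemma has_csum_lincomb u v a b c : has_csum u a -> has_csum v b ->
  has_csum (fun k => c * u k + v k) (c * a + b).
Proof.
case: c => cx cy; case: a => ax ay; case: b => bx b_y [/= u1 u2] [/= v1 v2].
split=> /=.
  have -> : series (fun k => complex.Re ((cx +i* cy)%C * u k + v k)) =
     (fun n => (cx * series (fun k => complex.Re (u k)) n -
         cy * series (fun k => complex.Im (u k)) n)
       + series (fun k => complex.Re (v k)) n).
    apply/funext => n; rewrite /series /= !big_distrr /= -sumrB -big_split /=.
    by apply: eq_bigr => k _; case: (u k); case: (v k).
  by apply: cvgD => //; apply: cvgB; apply: cvgM => //; exact: cvg_cst.
have -> : series (fun k => complex.Im ((cx +i* cy)%C * u k + v k)) =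
   (fun n => (cx * series (fun k => complex.Im (u k)) n + cy * series (fun k => complex.Re (u k)) n)
     + series (fun k => complex.Im (v k)) n).
  apply/funext => n; rewrite /series /= !big_distrr /= -!big_split /=.
  by apply: eq_bigr => k _; case: (u k); case: (v k) => ? ? ? ? /=; ring.
by apply: cvgD => //; apply: cvgD; apply: cvgM => //; exact: cvg_cst.
Qed.

Lemma has_csum_of_bound u (B : R) :
  (forall N, \sum_(k < N) normc (u k) <= B) -> has_csum u (csum u).
Proof.
move=> uB.
have cn : cvgn (series (fun k => normc (u k))).
  apply: nondecreasing_is_cvgn.
    by apply/nondecreasing_seqP => n; rewrite /series /= big_nat_recr //= lerDl normc_ge0.
  by exists B => _ [N _ <-]; rewrite /series /= big_mkord.
have aux (g : R[i] -> R) : (forall z, `|g z| <= normc z) -> cvgn (series (fun k => g (u k))).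
  move=> gn; apply: normed_cvg; apply: series_le_cvg cn => k /=.
  - exact: normr_ge0.
  - exact: normc_ge0.
  - exact: gn.
by split; apply: aux => z; [exact: normr_Re_le | exact: normr_Im_le].
Qed.

Lemma has_csum_single u n : (forall k, k != n -> u k = 0) -> has_csum u (u n).
Proof.
move=> u0.
have aux (g : R[i] -> R) : g 0 = 0 -> series (fun k => g (u k)) @ \oo --> g (u n).
  move=> g0; apply: cvg_near_cst.
  exists n.+1 => // N /= nN; rewrite /series /= big_mkord (bigD1 (Ordinal nN)) //= big1 ?addr0//.
  by move=> i; rewrite -val_eqE /= => /u0 ->.
by split; exact: aux.
Qed.

Lemma sqr_normc a : normc a ^+ 2 = complex.Re a ^+ 2 + complex.Im a ^+ 2.
Proof. by case: a => x y /=; rewrite sqr_sqrtr// addr_ge0 ?sqr_ge0. Qed.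

(** With N fixed the sum is a continuous function of finitely many limits, so a bound uniform in M
    survives M -> oo. *)
Lemma ler_sum_sqr_csum (u : nat -> nat -> R[i]) (l : nat -> R[i]) N (B : R) :
  (forall j, has_csum (u j) (l j)) ->
  (forall M, \sum_(j < N) normc (\sum_(k < M) u j k) ^+ 2 <= B) ->
  \sum_(j < N) normc (l j) ^+ 2 <= B.
Proof.
move=> ul uB.
have ReE v M : complex.Re (\sum_(k < M) v k : R[i]) = series (fun k => complex.Re (v k)) M.
  by rewrite /series /= big_mkord; elim/big_rec2: _ => // k x y _ <-; case: (v k); case: y.
have ImE v M : complex.Im (\sum_(k < M) v k : R[i]) = series (fun k => complex.Im (v k)) M.
  by rewrite /series /= big_mkord; elim/big_rec2: _ => // k x y _ <-; case: (v k); case: y.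
have cv : (fun M => \sum_(j < N) normc (\sum_(k < M) u j k) ^+ 2) @ \oo -->
    \sum_(j < N) normc (l j) ^+ 2.
  clear uB; elim: N => [|N IH].
    by rewrite big_ord0; under eq_fun do rewrite big_ord0; exact: cvg_cst.
  rewrite big_ord_recr /=; under eq_fun do rewrite big_ord_recr /= sqr_normc ReE ImE.
  have [h1 h2] := ul N.
  apply: cvgD => //; rewrite sqr_normc; apply: cvgD; rewrite expr2.
    by under eq_fun do rewrite expr2; exact: cvgM.
  by under eq_fun do rewrite expr2; exact: cvgM.
rewrite -(cvg_lim _ cv)//; apply: limr_le; first by apply/cvg_ex; eexists; exact: cv.
exact: nearW.
Qed.

End complex_series.

Section hardy_norms.
Context {R : realType}.
Implicit Types F G : hardy R.

Lemma normsq_le (a : nat -> R[i]) (B : R) :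
  (forall N, \sum_(k < N) normc (a k) ^+ 2 <= B) -> (normsq a <= B%:E)%E.
Proof.
move=> aB; apply: lime_le.
  by apply: is_cvg_nneseries => n _ _; rewrite lee_fin sqr_ge0.
by apply: nearW => N; rewrite sumEFin lee_fin big_mkord.
Qed.

Lemma normsq_lty F : (normsq F < +oo)%E.
Proof. by have /asboolP := taylorP F. Qed.

Lemma normsq_ge0 (a : nat -> R[i]) : (0 <= normsq a)%E.
Proof. by apply: nneseries_ge0 => k _ _; rewrite lee_fin sqr_ge0. Qed.

Lemma normsq_fin F : (fine (normsq F))%:E = normsq F.
Proof. by rewrite fineK// ge0_fin_numE ?normsq_ge0 ?normsq_lty. Qed.

Lemma normsq_ge F N : \sum_(k < N) normc (F k) ^+ 2 <= fine (normsq F).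
Proof.
rewrite -lee_fin normsq_fin -sumEFin -(big_mkord xpredT (fun k => (normc (F k) ^+ 2)%:E)).
by apply: nneseries_lim_ge => k _; rewrite lee_fin sqr_ge0.
Qed.

Lemma hardyD F G k : taylor (F + G) k = taylor F k + taylor G k. Proof. by []. Qed.
Lemma hardyZ (c : R[i]) F k : taylor (c *: F) k = c * taylor F k. Proof. by []. Qed.

End hardy_norms.

(** * Operators on the Hardy space given by matrices *)

Section matrix_operators.
Context {R : realType}.
Implicit Types (M : nat -> nat -> R[i]) (F G : hardy R).

Definition schur_bounded M :=
  exists2 C, 0 <= C & forall j k, normc (M j k) <= C * schur_kernel j k.

(** Stated with squared norms in the extended reals, so that differences and composites need no
    square roots; [norm_bounded_bounded] translates. *)
Definition norm_bounded (T : hardy R -> hardy R) :=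
  exists2 B, 0 <= B & forall F, (normsq (T F) <= B%:E * normsq F)%E.

Lemma norm_bounded_bounded (T : {linear hardy R -> hardy R}) :
  norm_bounded T -> bounded_operator T.
Proof.
move=> [B B0 TB]; exists (Num.sqrt B) => F; rewrite /hardy_norm -sqrtrM// ler_wsqrtr//.
by rewrite -lee_fin EFinM !normsq_fin.
Qed.

Lemma norm_boundedB (S T : {linear hardy R -> hardy R}) :
  norm_bounded S -> norm_bounded T -> norm_bounded (S \- T).
Proof.
move=> [B B0 SB] [B' B'0 TB]; exists (2 * B + 2 * B') => [|F].
  by rewrite addr_ge0 ?mulr_ge0.
rewrite -(normsq_fin F) -EFinM; apply: normsq_le => N.
have h1 := SB F; have h2 := TB F.
rewrite -(normsq_fin F) -(normsq_fin (S F)) -EFinM lee_fin in h1.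
rewrite -(normsq_fin F) -(normsq_fin (T F)) -EFinM lee_fin in h2.
apply: (@le_trans _ _ (2 * fine (normsq (S F)) + 2 * fine (normsq (T F)))); last by lra.
have n1 := normsq_ge (S F) N; have n2 := normsq_ge (T F) N.
apply: (@le_trans _ _ (2 * (\sum_(k < N) normc (S F k) ^+ 2) +
  2 * (\sum_(k < N) normc (T F k) ^+ 2))); last by lra.
rewrite !big_distrr /= -big_split /=; apply: ler_sum => k _.
suff : normc (S F k - T F k) ^+ 2 <= 2 * normc (S F k) ^+ 2 + 2 * normc (T F k) ^+ 2 by [].
move: (normcD (S F k) (- T F k)) (normc_ge0 (S F k - T F k)).
move: (normc_ge0 (S F k)) (normc_ge0 (T F k)).
rewrite normcN.
move: (normc (S F k - T F k)) (normc (S F k)) (normc (T F k)) => a c b c0 b0 abc a0.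
have : a ^+ 2 <= (c + b) ^+ 2 by rewrite ler_sqr ?nnegrE ?addr_ge0.
have := sqr_ge0 (c - b); rewrite !expr2; lra.
Qed.

Lemma norm_bounded_comp (S T : {linear hardy R -> hardy R}) :
  norm_bounded S -> norm_bounded T -> norm_bounded (S \o T).
Proof.
move=> [B B0 SB] [B' B'0 TB]; exists (B * B') => [|F]; first exact: mulr_ge0.
by apply: (le_trans (SB _)); rewrite EFinM -muleA lee_wpmul2l ?lee_fin.
Qed.

Section operator_of_matrix.
Variables (M : nat -> nat -> R[i]) (C : R).
Hypotheses (C0 : 0 <= C) (MC : forall j k, normc (M j k) <= C * schur_kernel j k).

(** The moduli stand inside the inner sum so that the same estimate gives absolute convergence of
    each row and the norm bound. *)
Let matrix_partial F N P :
  \sum_(j < N) (\sum_(k < P) normc (M j k * F k)) ^+ 2 <= 64 * C ^+ 2 * fine (normsq F).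
Proof.
apply: (@le_trans _ _ (\sum_(j < N) C ^+ 2 * (\sum_(k < P) schur_kernel j k * normc (F k)) ^+ 2)).
  apply: ler_sum => j _; rewrite -exprMn ler_sqr ?nnegrE; last 2 first.
  - by apply: sumr_ge0 => k _; exact: normc_ge0.
  - by rewrite mulr_ge0// sumr_ge0// => k _; rewrite mulr_ge0 ?schur_kernel_ge0 ?normc_ge0.
  rewrite big_distrr /=; apply: ler_sum => k _.
  by rewrite normcM mulrA ler_wpM2r ?normc_ge0.
rewrite -mulr_sumr [leRHS](_ : _ = C ^+ 2 * (64 * fine (normsq F))); last by ring.
apply: ler_wpM2l; first exact: sqr_ge0.
apply: (le_trans (schur_bound (fun k => normc (F k)) _ _)); rewrite ler_wpM2l//; exact: normsq_ge.
Qed.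

Let matrix_csum F j : has_csum (fun k => M j k * F k) (csum (fun k => M j k * F k)).
Proof.
set B := 64 * C ^+ 2 * fine (normsq F).
have B0 : 0 <= B by rewrite !mulr_ge0 ?exprn_ge0 ?fine_ge0 ?normsq_ge0.
apply: (@has_csum_of_bound _ _ (Num.sqrt B)) => P.
have s0 : 0 <= \sum_(k < P) normc (M j k * F k) by apply: sumr_ge0 => k _; exact: normc_ge0.
rewrite -(ger0_norm s0) -sqrtr_sqr ler_wsqrtr//.
(* Row j is the last of the first j + 1 rows, so its square is at most the sum over all of them. *)
apply: le_trans (matrix_partial F j.+1 P).
by rewrite big_ord_recr /= lerDr sumr_ge0// => i _; rewrite sqr_ge0.
Qed.

Let matrix_apply F : nat -> R[i] := fun j => csum (fun k => M j k * F k).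

Let matrix_apply_le F :
  (normsq (matrix_apply F) <= (64 * C ^+ 2)%:E * normsq F)%E.
Proof.
rewrite -(normsq_fin F) -EFinM; apply: normsq_le => N.
apply: (ler_sum_sqr_csum (u := fun j k => M j k * F k)); first exact: matrix_csum.
move=> P; apply: le_trans (matrix_partial F N P); apply: ler_sum => j _.
rewrite ler_sqr ?nnegrE ?normc_ge0 ?sumr_ge0//; last by move=> k _; exact: normc_ge0.
elim/big_rec2: _ => [|k x y _ h]; first by rewrite ComplexField.Normc.normc0.
by apply: (le_trans (normcD _ _)); rewrite lerD2l.
Qed.

Let matrix_applyP F : matrix_apply F \in @square_summable R.
Proof.
apply/asboolP; apply: (le_lt_trans (matrix_apply_le F)).
by rewrite -(normsq_fin F) -EFinM ltry.
Qed.

Definition matrix_operator F : hardy R := Hardy (matrix_applyP F).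

Lemma matrix_operator_linear : linear matrix_operator.
Proof.
move=> c F G; apply: val_inj; apply/funext => j.
apply: has_csum_csum.
have h := has_csum_lincomb c (matrix_csum F j) (matrix_csum G j).
suff -> : (fun k => M j k * (c *: F + G) k) = (fun k => c * (M j k * F k) + M j k * G k).
  exact: h.
by apply/funext => k; rewrite hardyD hardyZ mulrDr mulrCA.
Qed.

Lemma matrix_operator_norm_bounded : norm_bounded matrix_operator.
Proof. by exists (64 * C ^+ 2); [rewrite mulr_ge0 ?sqr_ge0 | exact: matrix_apply_le]. Qed.

Lemma matrix_operator_csum F j : has_csum (fun k => M j k * F k) (matrix_operator F j).
Proof. exact: matrix_csum. Qed.

Lemma matrix_operator_monomial k j : matrix_operator (monomial k) j = M j k.
Proof.
apply: has_csum_csum.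
rewrite -[X in has_csum _ X](_ : M j k * monomial k k = _); last by rewrite /= eqxx mulr1.
by apply: (has_csum_single (u := fun i => M j i * monomial k i)) => i /= /negbTE ->; rewrite mulr0.
Qed.

End operator_of_matrix.

(** The series for T F, with F arbitrary, is what turns the entries of a product of two such
    operators into sums over the intermediate index. *)
Lemma exists_operator_of_matrix M : schur_bounded M ->
  exists T : {linear hardy R -> hardy R},
  [/\ norm_bounded T, forall k j, T (monomial k) j = M j k
    & forall F j, has_csum (fun k => M j k * F k) (T F j)].
Proof.
move=> [C C0 MC]; pose T := matrix_operator C0 MC.
pose lT := GRing.isLinear.Build _ _ _ _ T (matrix_operator_linear C0 MC).
exists (HB.pack T lT : {linear hardy R -> hardy R}); split.
- exact: matrix_operator_norm_bounded.
- exact: matrix_operator_monomial.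
- exact: matrix_operator_csum.
Qed.

End matrix_operators.

(** * Riemann sums of the integrand *)

Section dominating_function.
Context {R : realType}.
Local Notation leb := (@lebesgue_measure R).
Variable a : R.
Hypothesis a0 : 0 < a.

(* Derivative of u |-> (1 - 1 / (1 + sqrt (a u))) / a, whose range is in [0, 1 / a]. *)
Definition sqrt_density (u : R) : R :=
  (2 * Num.sqrt (a * u) * (1 + Num.sqrt (a * u)) ^+ 2)^-1.

Let H (u : R) : R := a^-1 * (1 - (1 + Num.sqrt (a * u))^-1).

Lemma sqrt_density_ge0 u : 0 <= sqrt_density u.
Proof. by rewrite invr_ge0 mulr_ge0 ?sqr_ge0// mulr_ge0 ?sqrtr_ge0. Qed.

Let is_derive_H (u : R) : 0 < u -> is_derive u (1 : R) H (sqrt_density u).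
Proof.
move=> u0; have au : 0 < a * u by rewrite mulr_gt0.
have s0 : 0 < Num.sqrt (a * u) by rewrite sqrtr_gt0.
have s1 : 1 + Num.sqrt (a * u) != 0 by rewrite gt_eqF// ltr_pwDl ?sqrtr_ge0.
have d1 : is_derive u (1 : R) (fun u : R => a * u) a.
  by apply: (is_derive_eq (is_deriveZ a (is_derive_id u (1 : R)))); rewrite /GRing.scale /= mulr1.
have d2 := is_derive1_comp (is_derive1_sqrt au) d1.
have d3 := is_deriveD (is_derive_cst (1 : R) u 1) d2.
have d4 := is_deriveV (f := fun u : R => 1 + Num.sqrt (a * u)) s1 d3.
have d5 := is_deriveZ a^-1 (is_deriveB (is_derive_cst (1 : R) u 1) d4).
apply: (is_derive_eq d5); rewrite /sqrt_density /GRing.scale /=.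
move: (Num.sqrt (a * u)) s0 s1 => s s0 s1.
by field; rewrite s1 !gt_eqF.
Qed.

Let H_ge0 u : 0 <= H u.
Proof.
rewrite mulr_ge0 ?invr_ge0 ?(ltW a0)// subr_ge0 invf_le1 ?lerDl ?sqrtr_ge0//.
Qed.

Let H_le u : H u <= a^-1.
Proof. by rewrite ler_piMr ?invr_ge0 ?(ltW a0)// gerBl invr_ge0 addr_ge0 ?sqrtr_ge0. Qed.

Lemma continuous_sqrt_density (u : R) : 0 < u -> {for u, continuous sqrt_density}.
Proof.
move=> u0.
have s0 : 0 < Num.sqrt (a * u) by rewrite sqrtr_gt0 mulr_gt0.
have cs : {for u, continuous (fun u : R => Num.sqrt (a * u))}.
  by apply: continuous_comp; [exact: mulrl_continuous|exact: sqrt_continuous].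
have c1 : {for u, continuous (fun u : R => 1 + Num.sqrt (a * u))}.
  by apply: cvgD => //; exact: cvg_cst.
apply: cvgV; first by rewrite gt_eqF// !mulr_gt0// exprn_gt0// addr_gt0.
apply: cvgM; first by apply: cvgM => //; exact: cvg_cst.
by apply: cvgM.
Qed.

Lemma measurable_sqrt_density : measurable_fun (`]0, +oo[%classic : set R) sqrt_density.
Proof.
apply: open_continuous_measurable_fun => // u; rewrite inE /= in_itv /= andbT.
exact: continuous_sqrt_density.
Qed.

(** The primitive [H] takes values in [0, 1 / a], so the integral over each compact interval is at
    most 1 / a; monotone convergence does the rest. The density decays like (a u)^{-1/2} at 0 and (a
    u)^{-3/2} at infinity, the two rates of [cutoff] below. *)
Lemma integral_sqrt_density_le :
  (\int[leb]_(u in `]0%R, +oo[) (sqrt_density u)%:E <= (a^-1)%:E)%E.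
Proof.
pose F (k : nat) : set R := `[k.+1%:R^-1, k.+2%:R]%classic.
have -> : `]0%R, +oo[%classic = \bigcup_k F k.
  apply/seteqP; split => [u /=|u [k _]]; rewrite /F /= !in_itv /= ?andbT.
    move=> u0; pose k := Num.bound (u^-1 + u); exists k => //=; rewrite in_itv /=.
    have ui0 : 0 < u^-1 by rewrite invr_gt0.
    have hk : u^-1 + u < k%:R by apply: archi_boundP; rewrite addr_ge0// ltW.
    have k1 : k%:R <= k.+1%:R :> R by rewrite ler_nat.
    have k2 : k.+1%:R <= k.+2%:R :> R by rewrite ler_nat.
    by apply/andP; split; [rewrite invf_ple ?posrE//|]; lra.
  by move=> /andP[+ _]; apply: lt_le_trans; rewrite invr_gt0.
have cvF : (\int[leb]_(u in F k) (sqrt_density u)%:E)%E @[k --> \oo] -->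
    (\int[leb]_(u in \bigcup_k F k) (sqrt_density u)%:E)%E.
  apply: ge0_nondecreasing_set_cvg_integral.
  - apply/nondecreasing_seqP => k; rewrite subsetEset; apply: subset_itv; rewrite bnd_simp.
      by rewrite lef_pV2 ?posrE// ler_nat.
    by rewrite ler_nat.
  - by move=> k; exact: measurable_itv.
  - move=> k; apply/measurable_EFinP; apply: measurable_funS measurable_sqrt_density => //.
    by move=> u; rewrite /F /= !in_itv /= andbT => /andP[+ _]; apply: lt_le_trans; rewrite invr_gt0.
  - by move=> k u _; rewrite lee_fin sqrt_density_ge0.
rewrite -(cvg_lim _ cvF)//; apply: lime_le; first by apply/cvg_ex; eexists; exact: cvF.
apply: nearW => k.
have k0 : (0 : R) < k.+1%:R^-1 by rewrite invr_gt0.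
have kk : k.+1%:R^-1 < (k.+2%:R : R).
  by rewrite (@le_lt_trans _ _ 1) ?invf_le1 ?ler1n ?ltr1n.
have pos u : u \in `[k.+1%:R^-1, k.+2%:R] -> 0 < u.
  by rewrite in_itv /= => /andP[+ _]; exact: lt_le_trans.
have cH u : 0 < u -> {for u, continuous H}.
  move=> u0; apply: differentiable_continuous; apply/derivable1_diffP.
  by case: (is_derive_H u0).
rewrite (@continuous_FTC2 _ sqrt_density H)//.
- by rewrite -EFinB lee_fin (le_trans _ (H_le k.+2%:R))// gerBl H_ge0.
- apply: continuous_in_subspaceT => u; rewrite inE => /pos u0.
  exact: continuous_sqrt_density.
- split.
  + by move=> u /subset_itv_oo_cc /pos u0; case: (is_derive_H u0).
  + exact/cvg_at_right_filter/cH.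
  + by apply/cvg_at_left_filter/cH; exact: lt_trans kk.
- by move=> u /subset_itv_oo_cc /pos u0; rewrite derive1E; case: (is_derive_H u0).
Qed.

End dominating_function.

Section riemann_sums.
Context {R : realType}.
Local Notation leb := (@lebesgue_measure R).
Variables (G : R -> R) (h : R).
Hypothesis h0 : 0 < h.
Hypothesis iG : leb.-integrable (`]0, +oo[%classic : set R) (EFin \o G).

(** Each cell is closed at its node on the left, except the cell of index 0, which is open at the
    origin and has no node. *)
Let cell (k : nat) : set R :=
  if k is j.+1 then `[h * k%:R, h * k.+1%:R[%classic else `]0, h[%classic.

Let bigcup_cell : \bigcup_k cell k = `]0, +oo[%classic.
Proof.
apply/seteqP; split => [u [[|k] _ /=]|u /=]; rewrite !in_itv /= ?andbT.
- by case/andP.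
- by move=> /andP[+ _]; apply: lt_le_trans; rewrite mulr_gt0.
- move=> u0; pose k := Num.truncn (u / h).
  have := truncn_itv (divr_ge0 (ltW u0) (ltW h0)); rewrite -/k.
  rewrite ler_pdivlMr// ltr_pdivrMr// => /andP[k1 k2].
  exists k => //; rewrite /cell; case: k k1 k2 => [|k] k1 k2 /=; rewrite in_itv /=.
    by rewrite u0; move: k2; rewrite mul1r.
  by rewrite ![h * _]mulrC k1.
Qed.

Let trivIset_cell : trivIset setT cell.
Proof.
have lt k u : cell k u -> h * k%:R <= u < h * k.+1%:R.
  case: k => [|k] /=; rewrite in_itv //= mulr0 mulr1 => /andP[u0 ->].
  by rewrite ltW.
apply/trivIsetP => i j _ _; wlog ij : i j / (i < j)%N => [H|_].
  rewrite neq_ltn => /orP[ij|ij]; first by apply: H => //; rewrite neq_ltn ij.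
  by rewrite setIC; apply: H => //; rewrite neq_ltn ij.
apply/seteqP; split => // u [/lt /andP[_ ui] /lt /andP[ju _]].
have : h * i.+1%:R <= h * j%:R by rewrite ler_pM2l// ler_nat.
lra.
Qed.

Let measurable_cell k : measurable (cell k : set (measurableTypeR R)).
Proof. by case: k => [|k]; exact: measurable_itv. Qed.

Let integrable_cell k : leb.-integrable (cell k) (EFin \o G).
Proof.
apply: integrableS iG; [|exact: measurable_cell|]; first exact: measurable_itv.
by rewrite -bigcup_cell; exact: bigcup_sup.
Qed.

Lemma riemann_sum_bound (e : nat -> R) (e0 E L : R) :
  (forall k u, h * k.+1%:R <= u < h * k.+2%:R -> `|G (h * k.+1%:R) - G u| <= e k) ->
  Rintegral leb (`]0, h[%classic : set R) (fun u => `|G u|) <= e0 ->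
  (forall N, \sum_(k < N) e k <= E) ->
  series (fun k => h * G (h * k.+1%:R)) @ \oo --> L ->
  `|L - Rintegral leb (`]0, +oo[%classic : set R) G| <= e0 + h * E.
Proof.
move=> Ge int0 eE cL.
pose I k := Rintegral leb (cell k) G.
have Ifin k : (I k)%:E = (\int[leb]_(u in cell k) (G u)%:E)%E.
  rewrite /I /Rintegral fineK//.
  exact: (integrable_fin_num (measurable_cell k) (integrable_cell k)).
have cI : series I @ \oo --> Rintegral leb (`]0, +oo[%classic : set R) G.
  have fi : (\int[leb]_(u in `]0%R, +oo[) (G u)%:E)%E \is a fin_num.
    by apply: (integrable_fin_num _ iG); exact: measurable_itv.
  have := @integral_bigcup _ _ _ leb cell (EFin \o G) trivIset_cell measurable_cell.
  rewrite bigcup_cell => /(_ iG) /= hI.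
  have cvI : cvgn (series I).
    suff cn : cvgn (series (fun k => `|I k|)) by exact: normed_cvg.
    apply: nondecreasing_is_cvgn.
      by apply/nondecreasing_seqP => n; rewrite seriesSr lerDl.
    exists (fine (\int[leb]_(u in `]0%R, +oo[) `|(G u)%:E|)%E) => _ [N _ <-].
    have [mG finG] := integrableP _ _ _ iG.
    rewrite -lee_fin fineK; last by rewrite ge0_fin_numE ?integral_ge0.
    rewrite -bigcup_cell ge0_integral_bigcup//=; last first.
      by rewrite bigcup_cell; apply/measurable_EFinP; apply: measurableT_comp => //;
        exact/measurable_EFinP.
    apply: (@le_trans _ _ (\sum_(0 <= k < N) \int[leb]_(u in cell k) `|(G u)%:E|)%E).
      rewrite /series /= -sumEFin; apply: lee_sum => k _.
      rewrite -abse_EFin Ifin; apply: le_abse_integral => //.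
      by case/integrableP: (integrable_cell k).
    by apply: nneseries_lim_ge => k _ _; exact: integral_ge0.
  suff -> : Rintegral leb (`]0, +oo[%classic : set R) G = limn (series I) by [].
  rewrite /Rintegral hI -[RHS]/(fine (limn (series I))%:E) -EFin_lim//; congr (fine (limn _)).
  by apply/funext => n; rewrite /= /series /= -sumEFin; apply: eq_bigr => k _; rewrite Ifin.
have step k : `|h * G (h * k.+1%:R) - I k.+1| <= h * e k.
  have lebA : leb (cell k.+1 : set (measurableTypeR R)) = h%:E.
    rewrite /cell lebesgue_measure_itv /= lte_fin ltr_pM2l// ltr_nat ltnSn.
    by rewrite -EFinB -mulrBr -natrB// subSnn mulr1.
  have icst c : leb.-integrable (cell k.+1) (EFin \o cst c).
    apply/integrableP; split; first by apply/measurable_EFinP; exact: measurable_cst.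
    have := @integral_cst _ _ _ leb _ (measurable_cell k.+1) `|c|%:E.
    move=> hc; apply: (@le_lt_trans _ _ (`|c|%:E * h%:E)%E); last by rewrite -EFinM ltry.
    by rewrite -lebA le_eqVlt; apply/orP; left; apply/eqP; exact: hc.
  have mA := measurable_cell k.+1; have iA := integrable_cell k.+1.
  have cstE c : Rintegral leb (cell k.+1) (cst c) = h * c.
    have -> := @Rintegral_cst _ _ _ leb _ (measurable_cell k.+1) c.
    by rewrite mulrC; congr (_ * _); exact: (congr1 fine lebA).
  rewrite -[h * G _]cstE -[h * e k]cstE /I -(RintegralB mA (icst _) iA).
  apply: (le_trans (le_normr_Rintegral mA (integrableB mA (icst _) iA))).
  apply: le_Rintegral => //.
    exact: (integrable_norm (integrableB mA (icst _) iA)).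
    exact: icst.
  by move=> u /=; rewrite in_itv /= => uA; exact: Ge.
have first : `|I 0%N| <= e0.
  apply: le_trans int0; exact: (le_normr_Rintegral (measurable_cell 0) (integrable_cell 0)).
(* N nodes are set against N + 1 cells; the extra one is ]0, h[, estimated by e0. *)
have part N : `|series (fun k => h * G (h * k.+1%:R)) N - series I N.+1| <= e0 + h * E.
  rewrite /series /= !big_mkord big_ord_recl /= opprD addrCA.
  apply: (le_trans (ler_normD _ _)); rewrite normrN lerD//.
  rewrite -sumrB; apply: (le_trans (ler_norm_sum _ _ _)).
  apply: (@le_trans _ _ (\sum_(k < N) h * e k)); first by apply: ler_sum => k _; exact: step.
  by rewrite -mulr_sumr ler_wpM2l// ltW.
have cd : (fun N => `|series (fun k => h * G (h * k.+1%:R)) N - series I N.+1|) @ \oo -->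
    `|L - Rintegral leb (`]0, +oo[%classic : set R) G|.
  apply: cvg_norm; apply: cvgB => //.
  by rewrite (cvg_shiftS (series I)).
rewrite -(cvg_lim _ cd)//; apply: limr_le; first by apply/cvg_ex; eexists; exact: cd.
exact: nearW.
Qed.

End riemann_sums.

(** * Size of the integrand *)

Section envelope.
Context {R : realType}.
Implicit Types (m n alpha beta s : R).

(* With s = log x, this is (up to constants) the size of the integrand
   kappa u * eta (w / u) / u at u = x / a, where alpha = log a, beta = log b, w = b / a. *)
Definition envelope m n alpha beta s : R :=
  expR ((alpha - beta) / 2 + (alpha - s)) * (weight m (s - alpha) * weight n (beta - s)).

(** With x = e^s this is x^{-1/2} for x <= 1 and min (1, e^mu / x)^{3/2} for x > 1. *)
Definition cutoff mu s : R :=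
  if s <= 0 then expR (- s / 2) else expR (Order.min 0 (3 / 2 * (mu - s))).

Lemma envelope_bound m n : 0 <= m -> 0 <= n -> exists2 C, 0 < C &
  forall alpha beta s, 0 <= alpha -> 0 <= beta ->
  envelope m n alpha beta s <= C * (expR (alpha - beta) *
    (((1 + alpha) * (1 + beta)) `^ (m + n) * cutoff (Order.max alpha beta) s)).
Proof.
move=> m0 n0; have mn0 : 0 <= m + n by rewrite addr_ge0.
have [C C0 hC] := powR1D_le_expR mn0 (ltac:(lra) : (0 : R) < 1 / 2).
exists C => // al be s al0 be0.
set mu := Order.max al be.
have mu_al : al <= mu by rewrite le_max lexx.
have mu_be : be <= mu by rewrite le_max lexx orbT.
set Y := (1 + al) * (1 + be).
have Ymu : 1 + mu <= Y.
  by rewrite /mu /Y; case: (leP al be) => _; nra.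
have Y0 : 0 < Y by rewrite mulr_gt0// ltr_pwDl.
(* The distance from s to [0, mu]. It separates the powers of logarithms into a factor in [Y], which
   is kept, and a power of 1 + d, which is absorbed by e^{d/2}. *)
pose d : R := if s <= 0 then - s else if s <= mu then 0 else s - mu.
have d0 : 0 <= d by rewrite /d; case: ifPn => [|_]; [lra|case: ifPn => [//|]; rewrite -ltNge; lra].
have aux (t : R) : `|t| <= mu + d -> (1 + `|t|) <= Y * (1 + d).
  by move=> t0; apply: (@le_trans _ _ ((1 + mu) * (1 + d))); [nra|rewrite ler_wpM2r// addr_ge0].
have h1 : `|s - al| <= mu + d.
  rewrite /d ler_norml; case: ifPn => [|]; last rewrite -ltNge => s0.
    by move=> s0; apply/andP; split; lra.
  by case: ifPn => [|]; last rewrite -ltNge; move=> s1; apply/andP; split; lra.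
have h2 : `|be - s| <= mu + d.
  rewrite /d ler_norml; case: ifPn => [|]; last rewrite -ltNge => s0.
    by move=> s0; apply/andP; split; lra.
  by case: ifPn => [|]; last rewrite -ltNge; move=> s1; apply/andP; split; lra.
have poly : (1 + `|s - al|) `^ m * (1 + `|be - s|) `^ n <= Y `^ (m + n) * (C * expR (d / 2)).
  apply: (@le_trans _ _ ((Y * (1 + d)) `^ m * (Y * (1 + d)) `^ n)).
    by apply: ler_pM; rewrite ?powR_ge0//; apply: ge0_ler_powR => //;
      rewrite ?nnegrE ?addr_ge0// ?mulr_ge0 ?addr_ge0 ?(ltW Y0)//; exact: aux.
  have Yd : 0 < Y * (1 + d) by rewrite mulr_gt0// ltr_pwDl.
  rewrite -powRD; last by apply/implyP => _; rewrite gt_eqF.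
  rewrite powRM ?(ltW Y0) ?addr_ge0// ler_wpM2l ?powR_ge0//.
  by have := hC _ d0; rewrite (_ : 1 / 2 * d = d / 2)//; ring.
rewrite /envelope /weight mulrACA.
set A := (1 + `|s - al|) `^ m * _ in poly *.
set e1 := (al - be) / 2 + (al - s); set e2 := - `|s - al| / 2; set e3 := - `|be - s| / 2.
rewrite [leLHS](_ : _ = A * expR (e1 + (e2 + e3))); last first.
  by rewrite (expRD e1) (expRD e2); ring.
apply: (le_trans (ler_wpM2r (expR_ge0 _) poly)).
rewrite [leLHS](_ : _ = C * (Y `^ (m + n) * expR (e1 + (e2 + e3) + d / 2))); last first.
  by rewrite (expRD (e1 + (e2 + e3))); ring.
rewrite /e1 /e2 /e3.
rewrite ler_wpM2l ?(ltW C0)// mulrCA ler_wpM2l ?powR_ge0//.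
have n1 := ler_norm (s - al); have n2 := ler_norm (- (s - al)).
have n3 := ler_norm (be - s); have n4 := ler_norm (- (be - s)).
rewrite normrN in n2; rewrite normrN in n4.
(* Only exponents are left to compare. Relative to alpha - beta, they are 0 for s <= 0, nonpositive
   on [0, mu] and at most 2 (mu - s) beyond; adding d / 2 gives the exponents of [cutoff]. *)
rewrite /cutoff /d; case: ifPn => [s0|]; last rewrite -ltNge => s0.
  by rewrite -expRD ler_expR; lra.
rewrite -expRD ler_expR; case: ifPn => [s1|]; last rewrite -ltNge => s1.
  by rewrite min_l; lra.
by rewrite min_r; lra.
Qed.

End envelope.

(** * Variation of the integrand over one cell *)

Section integrand.
Context {R : realType}.
Implicit Types (kappa eta f g : R -> R[i]) (J : seq R) (m n K : R).

(** The conclusion of [FBV_regular], through which the kernels enter all estimates below. *)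
Definition regular_profile m K J f :=
  [/\ 0 < K,
      forall t, normc (f t) <= K * weight m t,
      measurable_fun setT (fun t => complex.Re (f t)),
      measurable_fun setT (fun t => complex.Im (f t))
    & forall x y, `|y - x| <= 1 ->
        (forall t, t \in J -> ~~ (Order.min x y <= t <= Order.max x y)) ->
        normc (f y - f x) <= K * weight m x * `|y - x|].

Definition integrand kappa eta (w u : R) : R[i] := kappa u * eta (w / u) * (u^-1)%:C%C.

Lemma kernel_profile kappa u : 0 < u ->
  kappa u = (expR (- ln u / 2))%:C%C * profile kappa (ln u).
Proof.
move=> u0; rewrite /profile lnK ?posrE// mulrA -rmorphM /= -expRD mulNr addNr expR0.
by rewrite mul1r.
Qed.

(** In the variable s = ln (a u) the factors e^{-t/2} of the two profiles and 1 / u merge into a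
    single exponential, and the profiles are evaluated at s - ln a and ln b - s. *)
Lemma integrandE kappa eta (a b u : R) : 0 < a -> 0 < b -> 0 < u ->
  integrand kappa eta (b / a) u =
  (expR ((ln a - ln b) / 2 + (ln a - ln (a * u))))%:C%C *
    (profile kappa (ln (a * u) - ln a) * profile eta (ln b - ln (a * u))).
Proof.
move=> a0 b0 u0; have au0 : 0 < a * u by rewrite mulr_gt0.
have lau : ln (a * u) = ln a + ln u by rewrite lnM.
have -> : ln (a * u) - ln a = ln u by rewrite lau addrC addKr.
have bau : 0 < b / a / u by rewrite !divr_gt0.
have lbau : ln (b / a / u) = ln b - ln (a * u).
  by rewrite -mulrA -invfM ln_div ?posrE// mulrC.
rewrite /integrand (kernel_profile kappa u0) (kernel_profile eta bau) lbau.
have -> : u^-1 = expR (- ln u) by rewrite expRN lnK.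
rewrite [LHS](_ : _ = (expR (- ln u / 2))%:C%C * (expR (- (ln b - ln (a * u)) / 2))%:C%C *
  (expR (- ln u))%:C%C * (profile kappa (ln u) * profile eta (ln b - ln (a * u)))); last by ring.
rewrite -!rmorphM /= -!expRD; congr ((expR _)%:C%C * _).
by rewrite lau; field.
Qed.

Variables (m n Kf Kg : R) (Jf Jg : seq R) (kappa eta : R -> R[i]).
Hypotheses (m0 : 0 <= m) (n0 : 0 <= n).
Hypotheses (rf : regular_profile m Kf Jf (profile kappa))
           (rg : regular_profile n Kg Jg (profile eta)).

Lemma normc_integrand (a b u : R) : 0 < a -> 0 < b -> 0 < u ->
  normc (integrand kappa eta (b / a) u) <=
  Kf * Kg * envelope m n (ln a) (ln b) (ln (a * u)).
Proof.
move=> a0 b0 u0; rewrite integrandE// normcM normc_real (ger0_norm (expR_ge0 _)).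
have [Kf0 bf _ _ _] := rf; have [Kg0 bg _ _ _] := rg.
rewrite /envelope [leRHS]mulrCA ler_wpM2l ?expR_ge0// normcM [leRHS]mulrACA.
by apply: ler_pM; rewrite ?normc_ge0.
Qed.

(* The number of jumps of the integrand at points x / a with x in [c, c + 1). *)
Definition jump_count (a b c : R) : R :=
  \sum_(t <- Jf) (c <= a * expR t < c + 1)%R%:R +
  \sum_(t <- Jg) (c <= b * expR (- t) < c + 1)%R%:R.

Lemma sum_indicator_eq0_or_ge1 (J : seq R) (P : pred R) :
  \sum_(t <- J) (P t)%:R = 0 :> R \/ 1 <= \sum_(t <- J) (P t)%:R :> R.
Proof.
elim: J => [|t J [IH|IH]]; rewrite ?big_nil ?big_cons; first by left.
  by rewrite IH addr0; case: (P t); [right|left].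
by right; rewrite (le_trans IH)// lerDr.
Qed.

Lemma sum_indicator_eq0P (J : seq R) (P : pred R) t :
  \sum_(t <- J) (P t)%:R = 0 :> R -> t \in J -> ~~ P t.
Proof.
elim: J => // u J IH; rewrite big_cons inE => /eqP.
rewrite paddr_eq0 ?sumr_ge0//.
move=> /andP[Pu /eqP/IH {}IH] /orP[/eqP ->|//].
by move: Pu; rewrite pnatr_eq0; case: (P u).
Qed.

(** If the cell contains a jump, [jump_count] is at least 1 and the sum of the two sizes suffices.
    Otherwise the exponential and the two profiles are changed one at a time, each at relative cost
    1 / c. *)
Lemma integrand_difference : exists2 C, 0 < C &
  forall a b c u : R, 0 < a -> 0 < b -> 1 <= c -> c <= a * u < c + 1 ->
  normc (integrand kappa eta (b / a) (a^-1 * c) - integrand kappa eta (b / a) u) <=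
  C * envelope m n (ln a) (ln b) (ln c) * (c^-1 + jump_count a b c).
Proof.
have [Kf0 bf _ _ lf] := rf; have [Kg0 bg _ _ lg] := rg.
pose Cm := (1 + 1) `^ m * expR (1 / 2) : R; pose Cn := (1 + 1) `^ n * expR (1 / 2) : R.
have Cm0 : 0 <= Cm by rewrite mulr_ge0 ?powR_ge0 ?expR_ge0.
have Cn0 : 0 <= Cn by rewrite mulr_ge0 ?powR_ge0 ?expR_ge0.
(* One summand for each term of [decomp]; [Cm] and [Cn] appear where a profile at the moved point is
   bounded by the weight at the node. *)
exists (Kf * Kg * (1 + Cn + Cm * Cn)) => [|a b c u a0 b0 c1 /andP[cx xc]].
  by rewrite mulr_gt0 ?(mulr_gt0 Kf0 Kg0)// ltr_pwDl ?mulr_ge0// ltr_pwDl.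
have c0 : 0 < c by exact: lt_le_trans c1.
have x0 : 0 < a * u by exact: lt_le_trans cx.
have u0 : 0 < u by rewrite -(pmulr_rgt0 _ a0).
have ac0 : 0 < a^-1 * c by rewrite mulr_gt0// invr_gt0.
rewrite !integrandE// (mulrA a) divff ?gt_eqF// mul1r.
set al := ln a; set be := ln b; set s0 := ln c; set s := ln (a * u).
have ss0 : s0 <= s by rewrite ler_ln ?posrE.
(* In logarithmic scale the cell [c, c + 1) has length at most 1 / c; this is where the gain comes
   from. *)
have ss1 : s - s0 <= c^-1.
  rewrite -ln_div ?posrE//.
  have -> : a * u / c = 1 + (a * u / c - 1) by rewrite addrC subrK.
  apply: (le_trans (le_ln1Dx _)); first by rewrite ltrBrDr addNr divr_gt0.
  by rewrite lerBlDr ler_pdivrMr// mulrDl mulVf ?gt_eqF// mul1r addrC ltW.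
have c1' : c^-1 <= 1 by rewrite invf_le1.
have dss : `|s - s0| <= 1 by rewrite ger0_norm ?subr_ge0// (le_trans ss1).
set E0 := expR ((al - be) / 2 + (al - s0)); set E := expR ((al - be) / 2 + (al - s)).
have E00 : 0 <= E0 by exact: expR_ge0.
have E1 : 0 <= E by exact: expR_ge0.
have EE0 : E <= E0 by rewrite ler_expR !lerD2l lerN2.
have EE1 : E0 - E <= E0 * c^-1.
  have -> : E = E0 * expR (- (s - s0)) by rewrite -expRD; congr expR; ring.
  rewrite -[X in X - _]mulr1 -mulrBr ler_wpM2l//; apply: le_trans ss1.
  by have := expR_ge1Dx (- (s - s0)); lra.
set f0 := profile kappa (s0 - al); set f1 := profile kappa (s - al).
set g0 := profile eta (be - s0); set g1 := profile eta (be - s).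
rewrite /envelope -/E0.
set Wm := weight m (s0 - al); set Wn := weight n (be - s0).
have Wm0 : 0 <= Wm by exact: weight_ge0.
have Wn0 : 0 <= Wn by exact: weight_ge0.
have Bf0 : normc f0 <= Kf * Wm by exact: bf.
have Bg0 : normc g0 <= Kg * Wn by exact: bg.
have Bf1 : normc f1 <= Kf * (Cm * Wm).
  apply: (le_trans (bf _)); rewrite ler_wpM2l ?(ltW Kf0)//; apply: weight_near => //.
  by rewrite opprB addrA subrK.
have Bg1 : normc g1 <= Kg * (Cn * Wn).
  apply: (le_trans (bg _)); rewrite ler_wpM2l ?(ltW Kg0)//; apply: weight_near => //.
  by rewrite (_ : be - s - (be - s0) = - (s - s0)) ?normrN//; ring.
have decomp : E0%:C%C * (f0 * g0) - E%:C%C * (f1 * g1) =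
    E0%:C%C * (f0 * (g0 - g1)) + E0%:C%C * ((f0 - f1) * g1) + (E0 - E)%:C%C * (f1 * g1).
  by rewrite rmorphB /=; ring.
have cv0 : 0 <= c^-1 by rewrite invr_ge0 ltW.
have jump0 (J : seq R) (P : pred R) : 0 <= \sum_(t <- J) (P t)%:R :> R.
  by apply: sumr_ge0 => t _; exact: ler0n.
have big : 1 <= jump_count a b c ->
    normc (E0%:C%C * (f0 * g0) - E%:C%C * (f1 * g1)) <=
    Kf * Kg * (1 + Cn + Cm * Cn) * (E0 * (Wm * Wn)) * (c^-1 + jump_count a b c).
  move=> j1; apply: (le_trans (normcD _ _)); rewrite normcN (normcM E0%:C%C) (normcM f0).
  rewrite (normcM E%:C%C) (normcM f1) !normc_real (ger0_norm E00) (ger0_norm E1).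
  have h0 : E0 * (normc f0 * normc g0) <= E0 * ((Kf * Wm) * (Kg * Wn)).
    by rewrite ler_wpM2l//; apply: ler_pM; rewrite ?normc_ge0.
  have h1 : E * (normc f1 * normc g1) <= E0 * ((Kf * (Cm * Wm)) * (Kg * (Cn * Wn))).
    by apply: ler_pM => //; [rewrite mulr_ge0 ?normc_ge0|apply: ler_pM; rewrite ?normc_ge0].
  apply: (le_trans (lerD h0 h1)).
  apply: (@le_trans _ _ (Kf * Kg * (1 + Cn + Cm * Cn) * (E0 * (Wm * Wn)) * 1)).
    have : 0 <= Kf * Kg * Cn * (E0 * (Wm * Wn)) by rewrite !mulr_ge0// ltW.
    by rewrite mulr1; lra.
  rewrite ler_wpM2l//; last by rewrite (le_trans j1)// lerDr.
  rewrite mulr_ge0 ?(mulr_ge0 E00 (mulr_ge0 Wm0 Wn0))// mulr_ge0 ?(mulr_ge0 (ltW Kf0) (ltW Kg0))//.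
  by rewrite !addr_ge0 ?mulr_ge0.
have [jf0|jf1] := sum_indicator_eq0_or_ge1 Jf (fun t => c <= a * expR t < c + 1); last first.
  by apply: big; rewrite (le_trans jf1)// lerDl.
have [jg0|jg1] := sum_indicator_eq0_or_ge1 Jg (fun t => c <= b * expR (- t) < c + 1); last first.
  by apply: big; rewrite (le_trans jg1)// lerDr.
have Df : normc (f0 - f1) <= Kf * Wm * c^-1.
  rewrite normcB; apply: (le_trans (lf (s0 - al) (s - al) _ _)).
  - by rewrite opprB addrA subrK.
  - move=> t /(sum_indicator_eq0P jf0); apply: contra.
    rewrite min_l ?lerD2r// max_r ?lerD2r// => /andP[t1 t2].
    rewrite -(lnK (x := a)) ?posrE// -(lnK (x := c)) ?posrE// -expRD ler_expR; apply/andP; split.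
      by move: t1; rewrite -/al -/s0; lra.
    rewrite lnK ?posrE//; apply: le_lt_trans xc.
    by rewrite -(lnK (x := a * u)) ?posrE// ler_expR; move: t2; rewrite -/al -/s; lra.
  rewrite ler_wpM2l ?mulr_ge0 ?(ltW Kf0)//.
  by rewrite opprB addrA subrK ger0_norm ?subr_ge0.
have Dg : normc (g0 - g1) <= Kg * Wn * c^-1.
  have sE : be - s - (be - s0) = - (s - s0) by ring.
  rewrite normcB; apply: (le_trans (lg (be - s0) (be - s) _ _)).
  - by rewrite sE normrN.
  - move=> t /(sum_indicator_eq0P jg0); apply: contra.
    rewrite min_r ?lerD2l ?lerN2// max_l ?lerD2l ?lerN2// => /andP[t1 t2].
    rewrite -(lnK (x := b)) ?posrE// -(lnK (x := c)) ?posrE// -expRD ler_expR; apply/andP; split.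
      by move: t2; rewrite -/be -/s0; lra.
    rewrite lnK ?posrE//; apply: le_lt_trans xc.
    by rewrite -(lnK (x := a * u)) ?posrE// ler_expR; move: t1; rewrite -/be -/s; lra.
  rewrite ler_wpM2l ?mulr_ge0 ?(ltW Kg0)//.
  by rewrite sE normrN ger0_norm ?subr_ge0.
rewrite /jump_count jf0 jg0 !addr0 decomp.
apply: (le_trans (normcD _ _)).
have T1 : normc (E0%:C%C * (f0 * (g0 - g1))) <= E0 * ((Kf * Wm) * (Kg * Wn * c^-1)).
  rewrite (normcM E0%:C%C) (normcM f0) normc_real (ger0_norm E00) ler_wpM2l//.
  by apply: ler_pM; rewrite ?normc_ge0.
have T2 : normc (E0%:C%C * ((f0 - f1) * g1)) <= E0 * ((Kf * Wm * c^-1) * (Kg * (Cn * Wn))).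
  rewrite (normcM E0%:C%C) (normcM (f0 - f1)) normc_real (ger0_norm E00) ler_wpM2l//.
  by apply: ler_pM; rewrite ?normc_ge0.
have T3 : normc ((E0 - E)%:C%C * (f1 * g1)) <= (E0 * c^-1) * ((Kf * (Cm * Wm)) * (Kg * (Cn * Wn))).
  rewrite (normcM (E0 - E)%:C%C) (normcM f1) normc_real ger0_norm ?subr_ge0//.
  by apply: ler_pM; rewrite ?subr_ge0 ?mulr_ge0 ?normc_ge0//; apply: ler_pM; rewrite ?normc_ge0.
apply: (le_trans (lerD (normcD _ _) (lexx _))).
apply: (le_trans (lerD (lerD T1 T2) T3)).
by rewrite le_eqVlt; apply/orP; left; apply/eqP; ring.
Qed.

End integrand.

(** * Sums over the cells *)

Section sums.
Context {R : realType}.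
Implicit Types (M z c : R).

Lemma sum_nat_indicator_le1 (z : R) N :
  \sum_(k < N) (k.+1%:R <= z < k.+1%:R + 1)%R%:R <= 1 :> R.
Proof.
suff -> : \sum_(k < N) (k.+1%:R <= z < k.+1%:R + 1)%R%:R = ((1 <= z < N%:R + 1)%R%:R : R).
  by case: (1 <= z < _); rewrite ?lexx ?ler01.
elim: N => [|N IH].
  by rewrite big_ord0 add0r; case: (1 <= z < 1) (le_lt_asym 1 z).
rewrite big_ord_recr /= IH -[N.+1]addn1 natrD /=.
have N0 : 0 <= N%:R :> R by [].
have [z1|z1] := ltP z 1.
  by rewrite (_ : (N%:R + 1 <= z) = false) ?addr0//; apply/negbTE; rewrite -ltNge; lra.
have [zN|zN] := ltP z (N%:R + 1); last by rewrite add0r.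
by rewrite (_ : z < N%:R + 1 + 1) ?addr0//; lra.
Qed.

(* Telescoping against log x - log (x + M). *)
Lemma log_telescope_step M c : 0 < M -> 1 <= c ->
  M / ((c + 1) * (c + 1 + M)) <=
  (ln (c + 1) - ln (c + 1 + M)) - (ln c - ln (c + M)).
Proof.
move=> M0 c1; have c0 : 0 < c by exact: lt_le_trans c1.
(* Chosen so that ln (1 + z) is the right-hand side; then ln (1 + z) >= z / (1 + z) = M / ((c + 1)
   (c + M)). *)
pose z := M / (c * (c + 1 + M)).
have p1 : 0 < c + 1 by lra. have p2 : 0 < c + 1 + M by lra. have p3 : 0 < c + M by lra.
have z0 : 0 < z by rewrite divr_gt0// mulr_gt0.
have -> : (ln (c + 1) - ln (c + 1 + M)) - (ln c - ln (c + M)) = - ln ((1 + z)^-1).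
  rewrite lnV ?posrE ?addr_gt0// opprK.
  have -> : 1 + z = ((c + 1) * (c + M)) / ((c + 1 + M) * c).
    by rewrite /z; field; rewrite !gt_eqF.
  by rewrite ln_div ?posrE ?mulr_gt0// !lnM ?posrE//; ring.
have h : (1 + z)^-1 = 1 + - (z / (1 + z)) by field; rewrite gt_eqF// addr_gt0.
have hz : z / (1 + z) = M / ((c + 1) * (c + M)).
  by rewrite /z; field; rewrite !gt_eqF//; nra.
rewrite h lerNr; apply: (@le_trans _ _ (- (z / (1 + z)))).
  apply: le_ln1Dx; rewrite ltrN2 ltr_pdivrMr ?addr_gt0// mul1r; lra.
rewrite lerN2 hz; apply: ler_wpM2l; first exact: ltW.
rewrite lef_pV2 ?posrE ?mulr_gt0//; apply: ler_wpM2l; lra.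
Qed.

Lemma cutoff_ge0 (mu s : R) : 0 <= cutoff mu s.
Proof. by rewrite /cutoff; case: ifP => _; exact: expR_ge0. Qed.

(** The decay exponent 3/2 is weakened to 1, which is enough for the sum: there a further factor 1 /
    c is present. *)
Lemma cutoff_ln_le (mu c : R) : 0 <= mu -> 1 <= c ->
  cutoff mu (ln c) <= 1 /\ cutoff mu (ln c) <= expR mu / c.
Proof.
move=> mu0 c1; have c0 : 0 < c by exact: lt_le_trans c1.
have lc0 : 0 <= ln c by exact: ln_ge0.
have Mc : expR mu / c = expR (mu - ln c) by rewrite expRB lnK ?posrE.
rewrite Mc /cutoff; case: ifPn => [h|_].
  have -> : ln c = 0 by apply/eqP; rewrite eq_le h.
  by rewrite subr0 oppr0 mul0r expR0; split=> //; rewrite -[leLHS]expR0 ler_expR.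
rewrite -[X in _ <= X /\ _]expR0 !ler_expR.
by case: (leP 0 (3 / 2 * (mu - ln c))) => h; split; lra.
Qed.

(** With M = e^mu, min (1, M / c) / c <= 2 M / (c (c + M)), which telescopes to a quantity of order
    ln (1 + M). This is the extra logarithm, responsible for the 1 in m + n + 1. *)
Lemma sum_cutoff_le (mu : R) N : 0 <= mu ->
  \sum_(k < N) cutoff mu (ln k.+1%:R) * k.+1%:R^-1 <= 4 + 2 * mu.
Proof.
move=> mu0; pose M := expR mu; have M1 : 1 <= M by rewrite -[leLHS]expR0 ler_expR.
have M0 : 0 < M by exact: lt_le_trans M1.
have term k : cutoff mu (ln k.+1%:R) * k.+1%:R^-1 <= 2 * (M / (k.+1%:R * (k.+1%:R + M))).
  have c1 : 1 <= k.+1%:R :> R by rewrite ler1n.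
  have c0 : 0 < k.+1%:R :> R by exact: lt_le_trans c1.
  have [h1 h2] := cutoff_ln_le mu0 c1.
  move: (k.+1%:R : R) c1 c0 h1 h2 => c c1 c0 h1 h2.
  rewrite (_ : 2 * _ = (2 * M / (c + M)) / c); last by field; rewrite !gt_eqF// addr_gt0.
  rewrite ler_wpM2r ?invr_ge0 ?(ltW c0)// ler_pdivlMr ?addr_gt0//.
  rewrite ler_pdivlMr// -/M in h2.
  have : cutoff mu (ln c) * M <= 1 * M by rewrite ler_wpM2r// ltW.
  lra.
pose L (x : R) := ln x - ln (x + M).
suff h n : \sum_(k < n.+1) 2 * (M / (k.+1%:R * (k.+1%:R + M))) <= 2 + 2 * (L n.+1%:R - L 1).
  case: N => [|N]; first by rewrite big_ord0; lra.
  apply: (@le_trans _ _ (2 + 2 * (L N.+1%:R - L 1))).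
    by apply: le_trans (h N); apply: ler_sum => k _; exact: term.
  have LN : L N.+1%:R <= 0 by rewrite subr_le0 ler_ln ?posrE ?addr_gt0// lerDl ltW.
  have L1 : - L 1 <= mu + 1.
    rewrite /L ln1 sub0r opprK.
    have -> : 1 + M = M * (1 + M^-1) by rewrite mulrDr mulr1 divff ?gt_eqF// addrC.
    have Mi0 : 0 < M^-1 by rewrite invr_gt0.
    rewrite lnM ?posrE ?addr_gt0// expRK lerD2l.
    by apply: (le_trans (le_ln1Dx _)); [lra|rewrite invf_le1].
  lra.
elim: n => [|n IH].
  rewrite big_ord1 subrr mulr0 addr0 /= mul1r.
  have : M / (1 + M) <= 1 by rewrite ler_pdivrMr ?addr_gt0//; lra.
  lra.
rewrite big_ord_recr /=; apply: (le_trans (lerD IH (lexx _))).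
have c1 : 1 <= n.+1%:R :> R by rewrite ler1n.
have := log_telescope_step M0 c1.
rewrite -[n.+2]addn1 natrD /L; lra.
Qed.

End sums.

(** * Domination by an integrable density *)

Section density_bounds.
Context {R : realType}.
Local Notation leb := (@lebesgue_measure R).
Variables (a : R).
Hypothesis a0 : 0 < a.

(** With q = sqrt (a u), the 8 comes from 2 q (1 + q)^2 <= 8 q for q <= 1 and <= 8 q^3 for q >= 1.
    The first bound estimates the cell at the origin and is uniform in mu; the second only yields
    integrability, so its growth in mu is harmless. *)
Lemma cutoff_le_sqrt_density (mu u : R) : 0 <= mu -> 0 < u ->
  (a * u <= 1 -> cutoff mu (ln (a * u)) <= 8 * sqrt_density a u) /\
  cutoff mu (ln (a * u)) <= 8 * expR (3 / 2 * mu) * sqrt_density a u.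
Proof.
move=> mu0 u0; have au0 : 0 < a * u by rewrite mulr_gt0.
pose q := Num.sqrt (a * u); have q0 : 0 < q by rewrite sqrtr_gt0.
have auq : a * u = q ^+ 2 by rewrite sqr_sqrtr// ltW.
have lq : ln (a * u) = 2 * ln q by rewrite auq lnXn// mulr_natl.
have Eq : q = expR (ln q) by rewrite lnK.
rewrite /sqrt_density -/q; move: auq q0 lq Eq; clearbody q => auq q0 lq Eq.
have D0 : 0 < 2 * q * (1 + q) ^+ 2 by rewrite mulr_gt0 ?exprn_gt0 ?addr_gt0 ?mulr_gt0.
have small : a * u <= 1 -> cutoff mu (ln (a * u)) <= 8 * (2 * q * (1 + q) ^+ 2)^-1.
  move=> au1; rewrite /cutoff ln_le0// lq.
  have -> : - (2 * ln q) / 2 = - ln q by field.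
  rewrite expRN -Eq ler_pdivlMr// mulrC ler_pdivrMr//.
  have q1 : q <= 1.
    by move: au1; rewrite auq expr2 => h; rewrite leNgt; apply/negP => q1; nra.
  have : (1 + q) ^+ 2 <= 2 ^+ 2 by rewrite ler_sqr ?nnegrE ?addr_ge0 ?(ltW q0)//; lra.
  have := ltW q0; move: ((1 + q) ^+ 2) => w; rewrite expr2; nra.
split=> //; have [au1|au1] := leP (a * u) 1.
  apply: (le_trans (small au1)); rewrite ler_wpM2r ?invr_ge0 ?(ltW D0)//.
  have : 1 <= expR (3 / 2 * mu) by rewrite -[leLHS]expR0 ler_expR; lra.
  lra.
have q1 : 1 < q.
  by move: au1; rewrite auq expr2 => h; rewrite ltNge; apply/negP => q1; nra.
have lq0 : 0 < ln (a * u) by rewrite ln_gt0.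
rewrite /cutoff (leNgt (ln _)) lq0 /=.
apply: (@le_trans _ _ (expR (3 / 2 * (mu - ln (a * u))))).
  by rewrite ler_expR ge_min lexx orbT.
rewrite [expR _](_ : _ = expR (3 / 2 * mu) * (q ^+ 3)^-1); last first.
  have -> : q ^+ 3 = expR (3 * ln q) by rewrite expRM_natl -Eq.
  by rewrite -expRN -expRD lq; congr expR; field.
rewrite [leRHS](_ : _ = expR (3 / 2 * mu) * (8 / (2 * q * (1 + q) ^+ 2))); last by ring.
rewrite ler_wpM2l ?expR_ge0//.
rewrite ler_pdivlMr// mulrC ler_pdivrMr ?exprn_gt0//.
have : (1 + q) ^+ 2 <= (2 * q) ^+ 2 by rewrite ler_sqr ?nnegrE ?addr_ge0 ?mulr_ge0 ?(ltW q0)//; lra.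
have := ltW q0; move: ((1 + q) ^+ 2) => w; rewrite !exprS !expr0; nra.
Qed.

Lemma integrable_sqrt_density :
  leb.-integrable (`]0, +oo[%classic : set R) (EFin \o sqrt_density a).
Proof.
apply/integrableP; split; first by apply/measurable_EFinP; exact: (measurable_sqrt_density a0).
under eq_integral do rewrite /= ger0_norm ?sqrt_density_ge0//.
by apply: (le_lt_trans (integral_sqrt_density_le a0)); rewrite ltry.
Qed.

Lemma integrable_le_sqrt_density (G : R -> R) (C : R) :
  measurable_fun (`]0, +oo[%classic : set R) G ->
  (forall u, 0 < u -> `|G u| <= C * sqrt_density a u) ->
  leb.-integrable (`]0, +oo[%classic : set R) (EFin \o G).
Proof.
move=> mG GC.
have mI : measurable (`]0, +oo[%classic : set (measurableTypeR R)) by exact: measurable_itv.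
apply: (le_integrable mI _ _ (integrableZl mI C integrable_sqrt_density)).
  exact/measurable_EFinP.
move=> u /=; rewrite in_itv /= andbT => u0; rewrite lee_fin.
by apply: (le_trans (GC u u0)); exact: ler_norm.
Qed.

Lemma Rintegral_le_sqrt_density (G : R -> R) (h C : R) :
  0 <= C ->
  leb.-integrable (`]0, +oo[%classic : set R) (EFin \o G) ->
  (forall u, 0 < u < h -> `|G u| <= C * sqrt_density a u) ->
  Rintegral leb (`]0, h[%classic : set R) (fun u => `|G u|) <= C * a^-1.
Proof.
move=> C0 iG GC.
have mI : measurable (`]0, h[%classic : set (measurableTypeR R)) by exact: measurable_itv.
have mI' : measurable (`]0, +oo[%classic : set (measurableTypeR R)) by exact: measurable_itv.
have sub : `]0, h[%classic `<=` (`]0, +oo[%classic : set (measurableTypeR R)).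
  by move=> u /=; rewrite !in_itv /= andbT => /andP[].
have iD := integrableS mI' mI sub integrable_sqrt_density.
have iGh := integrableS mI' mI sub iG.
apply: (@le_trans _ _ (Rintegral leb (`]0, h[%classic : set R) (fun u => C * sqrt_density a u))).
  apply: le_Rintegral => //.
  - exact: (integrable_norm iGh).
  - exact: (integrableZl mI C iD).
rewrite RintegralZl// ler_wpM2l// -lee_fin /Rintegral fineK; last exact: (integrable_fin_num mI iD).
apply: le_trans (integral_sqrt_density_le a0).
apply: ge0_subset_integral => //.
- by apply/measurable_EFinP; exact: (measurable_sqrt_density a0).
- by move=> u _; rewrite lee_fin sqrt_density_ge0.
Qed.

End density_bounds.

(** * The Riemann sum against the integral *)

Section defect.
Context {R : realType}.
Local Notation leb := (@lebesgue_measure R).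
Variables (m n Kf Kg : R) (Jf Jg : seq R) (kappa eta : R -> R[i]).
Hypotheses (m0 : 0 <= m) (n0 : 0 <= n).
Hypotheses (rf : regular_profile m Kf Jf (profile kappa))
           (rg : regular_profile n Kg Jg (profile eta)).

Let measurable_shifted (g : R -> R) (h : R -> R) :
  measurable_fun setT g -> measurable_fun setT h -> measurable_fun setT (fun u => g (h u)).
Proof. by move=> mg mh; exact: (measurableT_comp mg mh). Qed.

Lemma measurable_integrand (a b : R) : 0 < a -> 0 < b ->
  measurable_fun (`]0, +oo[%classic : set R)
    (fun u => complex.Re (integrand kappa eta (b / a) u)) /\
  measurable_fun (`]0, +oo[%classic : set R)
    (fun u => complex.Im (integrand kappa eta (b / a) u)).
Proof.
move=> a0 b0; have [_ _ fRe fIm _] := rf; have [_ _ gRe gIm _] := rg.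
have ml : measurable_fun setT (fun u : R => ln (a * u)).
  apply: (@measurable_shifted (@ln R) (fun u => a * u)); first exact: measurable_ln.
  by apply: continuous_measurable_fun; exact: mulrl_continuous.
pose e u := expR ((ln a - ln b) / 2 + (ln a - ln (a * u))).
have me : measurable_fun setT e.
  apply: (@measurable_shifted expR (fun u => (ln a - ln b) / 2 + (ln a - ln (a * u))));
    first exact: measurable_expR.
  by apply: measurable_funD => //; exact: measurable_funB.
have m1 : measurable_fun setT (fun u : R => ln (a * u) - ln a) by exact: measurable_funB.
have m2 : measurable_fun setT (fun u : R => ln b - ln (a * u)) by exact: measurable_funB.
have fR := measurable_shifted fRe m1; have fI := measurable_shifted fIm m1.
have gR := measurable_shifted gRe m2; have gI := measurable_shifted gIm m2.
split.
  apply: (@eq_measurable_fun _ _ _ _ _ (fun u => e u *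
    (complex.Re (profile kappa (ln (a * u) - ln a)) * complex.Re (profile eta (ln b - ln (a * u))) -
     complex.Im (profile kappa (ln (a * u) - ln a)) *
     complex.Im (profile eta (ln b - ln (a * u)))))).
    move=> u; rewrite inE /= in_itv /= andbT => u0; rewrite integrandE//.
    apply/esym; rewrite [LHS]ReM_real.
    by congr (_ * _); exact: ReM.
  apply: (measurable_funS measurableT) => //; apply: measurable_funM => //.
  by apply: measurable_funB; exact: measurable_funM.
apply: (@eq_measurable_fun _ _ _ _ _ (fun u => e u *
  (complex.Re (profile kappa (ln (a * u) - ln a)) * complex.Im (profile eta (ln b - ln (a * u))) +
   complex.Im (profile kappa (ln (a * u) - ln a)) * complex.Re (profile eta (ln b - ln (a * u)))))).
  move=> u; rewrite inE /= in_itv /= andbT => u0; rewrite integrandE//.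
  apply/esym; rewrite [LHS]ImM_real.
  by congr (_ * _); exact: ImM.
apply: (measurable_funS measurableT) => //; apply: measurable_funM => //.
by apply: measurable_funD; exact: measurable_funM.
Qed.

Lemma sum_jump_count_le (a b : R) N :
  \sum_(k < N) jump_count Jf Jg a b k.+1%:R <= (size Jf)%:R + (size Jg)%:R.
Proof.
have aux (J : seq R) (z : R -> R) :
    \sum_(k < N) \sum_(t <- J) (k.+1%:R <= z t < k.+1%:R + 1)%R%:R <= (size J)%:R :> R.
  rewrite exchange_big /= -sum1_size natr_sum.
  by apply: ler_sum => t _; exact: sum_nat_indicator_le1.
by rewrite big_split /=; apply: lerD; exact: aux.
Qed.

Lemma riemann_sum_integrand : exists2 C, 0 < C &
  forall (rho : R[i] -> R) (a b L : R), 1 <= a -> 1 <= b ->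
  (forall z w, rho (z - w) = rho z - rho w) -> (forall z, `|rho z| <= normc z) ->
  measurable_fun (`]0, +oo[%classic : set R)
    (fun u => rho (integrand kappa eta (b / a) u)) ->
  series (fun k => a^-1 * rho (integrand kappa eta (b / a) (a^-1 * k.+1%:R))) @ \oo --> L ->
  `|L - Rintegral leb (`]0, +oo[%classic : set R)
      (fun u => rho (integrand kappa eta (b / a) u))| <=
    C * (b^-1 * ((1 + ln a) * (1 + ln b)) `^ (m + n + 1)).
Proof.
have [C0 C00 hC0] := integrand_difference m0 n0 rf rg.
have [C1 C10 hC1] := envelope_bound m0 n0 (R := R).
have [Kf0 _ _ _ _] := rf; have [Kg0 _ _ _ _] := rg.
pose J : R := (size Jf)%:R + (size Jg)%:R.
have J0 : 0 <= J by rewrite addr_ge0.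
(* The first summand is for the cell at the origin, the second for all others, by way of 4 + 2 mu +
   J <= (4 + J) Y. *)
exists (8 * (Kf * Kg) * C1 + C0 * C1 * (4 + J)) => [|rho a b L a1 b1 rhoB rho_le mrho cL].
  by rewrite addr_gt0// !mulr_gt0// ltr_pwDl.
have a0 : 0 < a by exact: lt_le_trans a1.
have b0 : 0 < b by exact: lt_le_trans b1.
have al0 : 0 <= ln a by exact: ln_ge0.
have be0 : 0 <= ln b by exact: ln_ge0.
set mu := Order.max (ln a) (ln b); set Y := (1 + ln a) * (1 + ln b).
have mu0 : 0 <= mu by rewrite le_max al0.
have Y1 : 1 + mu <= Y by rewrite /mu /Y; case: (leP (ln a) (ln b)) => _; nra.
have Y0 : 0 < Y by apply: lt_le_trans Y1; rewrite ltr_pwDl.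
have env s : envelope m n (ln a) (ln b) s <= C1 * (a / b * Y `^ (m + n)) * cutoff mu s.
  have := hC1 (ln a) (ln b) s al0 be0; rewrite -/mu -/Y expRB !lnK//.
  by rewrite -[C1 * _ * _]mulrA -[a / b * _ * _]mulrA.
have P0 : 0 <= C1 * (a / b * Y `^ (m + n)).
  by rewrite !mulr_ge0 ?powR_ge0 ?invr_ge0 ?(ltW C10) ?(ltW a0) ?(ltW b0).
set G := fun u => rho (integrand kappa eta (b / a) u) in mrho cL *.
have KK0 : 0 <= Kf * Kg by rewrite mulr_ge0 ?(ltW Kf0) ?(ltW Kg0).
have Gle u : 0 < u -> `|G u| <= Kf * Kg * (C1 * (a / b * Y `^ (m + n))) * cutoff mu (ln (a * u)).
  move=> u0; apply: (le_trans (rho_le _)); apply: (le_trans (normc_integrand rf rg a0 b0 u0)).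
  by rewrite -[leRHS]mulrA ler_wpM2l.
set B := Kf * Kg * (C1 * (a / b * Y `^ (m + n))) in Gle.
have B0 : 0 <= B by rewrite mulr_ge0.
have iG : leb.-integrable (`]0, +oo[%classic : set R) (EFin \o G).
  apply: (integrable_le_sqrt_density a0 (C := B * (8 * expR (3 / 2 * mu)))) => // u u0.
  apply: (le_trans (Gle u u0)); rewrite -[leRHS]mulrA ler_wpM2l//.
  by have [] := cutoff_le_sqrt_density a0 mu0 u0.
have ai0 : 0 < a^-1 by rewrite invr_gt0.
pose e k := C0 * envelope m n (ln a) (ln b) (ln k.+1%:R) *
  (k.+1%:R^-1 + jump_count Jf Jg a b k.+1%:R).
have h1 k u : a^-1 * k.+1%:R <= u < a^-1 * k.+2%:R -> `|G (a^-1 * k.+1%:R) - G u| <= e k.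
  move=> /andP[u1 u2]; rewrite -rhoB; apply: (le_trans (rho_le _)); apply: hC0 => //.
    by rewrite ler1n.
  rewrite -(ler_pM2l a0) mulrA divff ?gt_eqF// mul1r in u1.
  rewrite -(ltr_pM2l a0) mulrA divff ?gt_eqF// mul1r in u2.
  by rewrite u1 natr1.
have h2 : Rintegral leb (`]0, a^-1[%classic : set R) (fun u => `|G u|) <= B * 8 * a^-1.
  apply: (Rintegral_le_sqrt_density a0) => //; first by rewrite mulr_ge0.
  move=> u /andP[u0 ua]; apply: (le_trans (Gle u u0)); rewrite -mulrA ler_wpM2l//.
  have [+ _] := cutoff_le_sqrt_density a0 mu0 u0; apply.
  by rewrite mulrC -ler_pdivlMr// mul1r ltW.
have h3 N : \sum_(k < N) e k <= C0 * (C1 * (a / b * Y `^ (m + n))) * (4 + 2 * mu + J).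
  pose ct k := cutoff mu (ln k.+1%:R).
  apply: (@le_trans _ _ (\sum_(k < N) C0 * (C1 * (a / b * Y `^ (m + n))) *
      (ct k * k.+1%:R^-1 + jump_count Jf Jg a b k.+1%:R))).
    apply: ler_sum => k _.
    have jc0 : 0 <= jump_count Jf Jg a b k.+1%:R.
      by rewrite addr_ge0// sumr_ge0// => t _; exact: ler0n.
    have ct0 : 0 <= ct k by exact: cutoff_ge0.
    have k1 : 1 <= k.+1%:R :> R by rewrite ler1n.
    have [ct1 _] := cutoff_ln_le mu0 k1.
    apply: (@le_trans _ _ (C0 * (C1 * (a / b * Y `^ (m + n))) *
       (ct k * (k.+1%:R^-1 + jump_count Jf Jg a b k.+1%:R)))).
      have w0 : 0 <= k.+1%:R^-1 + jump_count Jf Jg a b k.+1%:R.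
        by apply: addr_ge0; rewrite ?invr_ge0.
      rewrite /e [leRHS]mulrA; apply: (ler_wpM2r w0).
      by rewrite -[leRHS]mulrA ler_wpM2l ?(ltW C00)//; exact: env.
    apply: ler_wpM2l; first by rewrite mulr_ge0 ?(ltW C00).
    (* The cutoff is kept next to 1 / c, where it makes the sum converge, and replaced by 1 next to
       the jump count, whose sum is at most J. *)
    by rewrite mulrDr lerD2l ler_piMl.
  rewrite -mulr_sumr; apply: ler_wpM2l; first by rewrite mulr_ge0 ?(ltW C00).
  by rewrite big_split /=; apply: lerD; [exact: sum_cutoff_le|exact: sum_jump_count_le].
apply: (le_trans (riemann_sum_bound ai0 iG h1 h2 h3 cL)).
have hY : 4 + 2 * mu + J <= (4 + J) * Y by nra.
have Y1' : 1 <= Y by lra.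
have YE : Y `^ (m + n + 1) = Y `^ (m + n) * Y 
  by rewrite powRD; [rewrite powRr1 ?(ltW Y0)|apply/implyP => _; rewrite gt_eqF].
rewrite YE /B; move: (Y `^ (m + n)) (powR_ge0 Y (m + n)) => Z Z0.
rewrite [leLHS](_ : _ = 8 * (Kf * Kg) * C1 * (b^-1 * Z) +
  C0 * C1 * (b^-1 * Z) * (4 + 2 * mu + J)); last first.
  by field; rewrite !gt_eqF.
have bZ : 0 <= b^-1 * Z by rewrite mulr_ge0 ?invr_ge0 ?(ltW b0).
clearbody Y; rewrite [leRHS](_ : _ = 8 * (Kf * Kg) * C1 * (b^-1 * Z * Y) +
  C0 * C1 * (b^-1 * Z) * ((4 + J) * Y)); last by ring.
apply: lerD; apply: ler_wpM2l => //.
- by rewrite !mulr_ge0 ?(ltW C10) ?(ltW Kf0) ?(ltW Kg0).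
- by rewrite ler_peMr.
- by apply: mulr_ge0 bZ; rewrite mulr_ge0 ?(ltW C10) ?(ltW C00).
Qed.

End defect.

(** * The defect of multiplicativity *)

Section assembly.
Context {R : realType}.
Local Notation leb := (@lebesgue_measure R).

Lemma root4E k : root4 k.+1 = expR (ln k.+1%:R / 4) :> R.
Proof.
apply: (@pexpIrn _ 4); rewrite ?nnegrE ?root4_ge0 ?expR_ge0//.
rewrite root4X -expRM_natl mulrCA divff// mulr1 lnK ?posrE//.
Qed.

Lemma schur_kernelE j k : schur_kernel j k =
  expR (- (ln j.+1%:R + ln k.+1%:R) / 2 - `|ln k.+1%:R - ln j.+1%:R| / 4) :> R.
Proof.
rewrite /schur_kernel !root4E -!expRM_natl -!expRD -!expRN.
case: ifPn => [kj|]; last rewrite -ltnNge => jk; congr expR.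
  by rewrite distrC ger0_norm ?subr_ge0 ?ler_ln ?posrE ?ler_nat//; field.
by rewrite ger0_norm ?subr_ge0 ?ler_ln ?posrE ?ler_nat 1?ltnW//; field.
Qed.

(** With t = ln (c / a), the entry is at most (a c)^{-1/2} times K [weight m t]. Half of e^{-|t|/2}
    absorbs the power of 1 + |t|, and the remaining e^{-|t|/4} is exactly that of the Schur
    kernel. *)
Lemma W_schur_bounded (m K : R) (J : seq R) (kappa : R -> R[i]) : 0 <= m ->
  regular_profile m K J (profile kappa) -> schur_bounded (W kappa).
Proof.
move=> m0 [K0 bf _ _ _].
have [C C0 hC] := powR1D_le_expR m0 (ltac:(lra) : (0 : R) < 1 / 4).
exists (K * C) => [|j k]; first by rewrite mulr_ge0 ?ltW.
have a0 : 0 < j.+1%:R :> R by []. have c0 : 0 < k.+1%:R :> R by [].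
have ca0 : 0 < k.+1%:R / j.+1%:R :> R by rewrite divr_gt0.
rewrite /W normcM normc_real (kernel_profile kappa ca0) normcM normc_real.
rewrite !ger0_norm ?expR_ge0 ?invr_ge0// ln_div ?posrE// schur_kernelE.
set al := ln j.+1%:R; set ga := ln k.+1%:R.
have -> : j.+1%:R^-1 = expR (- al) :> R by rewrite expRN lnK.
apply: (@le_trans _ _ (expR (- al) * (expR (- (ga - al) / 2) *
   (K * (C * expR (1 / 4 * `|ga - al|) * expR (- `|ga - al| / 2)))))).
  rewrite !ler_wpM2l ?expR_ge0//; apply: (le_trans (bf _)).
  by rewrite ler_wpM2l ?(ltW K0)// ler_wpM2r ?expR_ge0//; exact: hC.
rewrite [leLHS](_ : _ = K * C * (expR (- al) * expR (- (ga - al) / 2) *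
  expR (1 / 4 * `|ga - al|) * expR (- `|ga - al| / 2))); last by ring.
rewrite -!expRD ler_wpM2l ?mulr_ge0 ?(ltW K0) ?(ltW C0)// ler_expR le_eqVlt.
by apply/orP; left; apply/eqP; field.
Qed.

(** In each variable the logarithms cost a quarter power, and the remaining exponent 3/4 exceeds the
    1/2 needed for square summability. *)
Lemma polylog_le_root4 (p : R) : 0 <= p -> exists2 C, 0 < C & forall j l,
  (j.+1%:R * l.+1%:R)^-1 * ((1 + ln j.+1%:R) * (1 + ln l.+1%:R)) `^ p <=
  C * (root4 j.+1 ^+ 3 * root4 l.+1 ^+ 3)^-1 :> R.
Proof.
move=> p0; have [C C0 hC] := powR1D_le_expR p0 (ltac:(lra) : (0 : R) < 1 / 4).
exists (C ^+ 2) => [|j l]; first exact: exprn_gt0.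
have ln0 k : 0 <= ln k.+1%:R :> R by apply: ln_ge0; rewrite ler1n.
have one k : k.+1%:R^-1 * (1 + ln k.+1%:R) `^ p <= C * (root4 k.+1 ^+ 3)^-1 :> R.
  apply: (@le_trans _ _ (k.+1%:R^-1 * (C * expR (1 / 4 * ln k.+1%:R)))).
    by rewrite ler_wpM2l ?invr_ge0//; exact: hC.
  rewrite (_ : 1 / 4 * ln k.+1%:R = ln k.+1%:R / 4); last by field.
  rewrite -root4E -(root4X k.+1).
  have r0 := @root4_gt0 R k.
  by rewrite le_eqVlt; apply/orP; left; apply/eqP; field; rewrite gt_eqF.
rewrite powRM ?addr_ge0// [in leLHS]invfM mulrACA.
rewrite [leRHS](_ : _ = (C / root4 j.+1 ^+ 3) * (C / root4 l.+1 ^+ 3)); last first.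
  by rewrite (invfM (root4 _ ^+ 3)); ring.
by apply: ler_pM; rewrite ?mulr_ge0 ?powR_ge0 ?invr_ge0.
Qed.

(** Makes the matrix of the defect subject to Schur's test, so that it defines an operator. *)
Lemma root4_product_le_schur_kernel j l :
  (root4 j.+1 ^+ 3 * root4 l.+1 ^+ 3)^-1 <= schur_kernel j l :> R.
Proof.
have rj := @root4_gt0 R j; have rl := @root4_gt0 R l.
have r3 k : root4 k.+1 <= root4 k.+1 ^+ 3 :> R.
  rewrite exprS ler_peMr ?root4_ge0//; have := @root4_ge1 R k; rewrite expr2 => h.
  by rewrite mulr_ege1.
rewrite /schur_kernel; case: ifPn => _; rewrite lef_pV2 ?posrE ?mulr_gt0 ?exprn_gt0//.
  by rewrite ler_wpM2l ?exprn_ge0 ?root4_ge0.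
by rewrite [leRHS]mulrC ler_wpM2l ?exprn_ge0 ?root4_ge0.
Qed.

Lemma hilbert_schmidt_sum_lty (M : nat -> nat -> R[i]) (C : R) :
  (forall j l, normc (M j l) <= C * (root4 j.+1 ^+ 3 * root4 l.+1 ^+ 3)^-1) ->
  (\sum_(0 <= l <oo) normsq (fun j => M j l) < +oo)%E.
Proof.
move=> MC.
have C0 : 0 <= C.
  have := le_trans (normc_ge0 _) (MC 0%N 0%N).
  by rewrite pmulr_lge0// invr_gt0 mulr_gt0 ?exprn_gt0 ?root4_gt0.
have col l : (normsq (fun j => M j l) <= (5 * C ^+ 2 * (root4 l.+1 ^+ 6)^-1)%:E)%E.
  apply: normsq_le => N.
  apply: (@le_trans _ _ (\sum_(j < N) C ^+ 2 * (root4 l.+1 ^+ 6)^-1 * (root4 j.+1 ^+ 6)^-1)).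
    apply: ler_sum => j _.
    have -> : C ^+ 2 * (root4 l.+1 ^+ 6)^-1 * (root4 j.+1 ^+ 6)^-1 =
        (C * (root4 j.+1 ^+ 3 * root4 l.+1 ^+ 3)^-1) ^+ 2.
      by have r1 := @root4_gt0 R j; have r2 := @root4_gt0 R l; field; rewrite !gt_eqF.
    by rewrite ler_sqr ?nnegrE ?normc_ge0// (le_trans (normc_ge0 _) (MC _ _)).
  rewrite -mulr_sumr [leRHS](_ : _ = C ^+ 2 * (root4 l.+1 ^+ 6)^-1 * 5); last by ring.
  apply: ler_wpM2l; last exact: sum_root4_inv6.
  by rewrite mulr_ge0 ?sqr_ge0// invr_ge0 exprn_ge0// root4_ge0.
apply: (@le_lt_trans _ _ (5 * C ^+ 2 * 5)%:E); last by rewrite ltry.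
apply: lime_le; first by apply: is_cvg_nneseries => l _ _; exact: normsq_ge0.
apply: nearW => N.
apply: (@le_trans _ _ (\sum_(0 <= l < N) (5 * C ^+ 2 * (root4 l.+1 ^+ 6)^-1)%:E)%E).
  by apply: lee_sum => l _; exact: col.
rewrite sumEFin lee_fin big_mkord -mulr_sumr; apply: ler_wpM2l; last exact: sum_root4_inv6.
by rewrite mulr_ge0 ?sqr_ge0.
Qed.

(** Of the two factors 1 / (j + 1), one is the mesh of the Riemann sum and the other the prefactor
    in the entries of W(kappa * eta). *)
Lemma W_mul_integrand (kappa eta : R -> R[i]) j k l :
  W kappa j k * W eta k l =
  (j.+1%:R^-1 * j.+1%:R^-1)%:C%C *
    integrand kappa eta (l.+1%:R / j.+1%:R) (j.+1%:R^-1 * k.+1%:R).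
Proof.
have a0 : j.+1%:R != 0 :> R by []. have c0 : k.+1%:R != 0 :> R by [].
rewrite /W /integrand.
move: (j.+1%:R : R) (k.+1%:R : R) (l.+1%:R : R) a0 c0 => a c b a0 c0.
rewrite [_^-1 * c]mulrC.
have -> : b / a / (c / a) = b / c by field; rewrite a0 c0.
have -> : (c / a)^-1 = a * c^-1 by rewrite invfM invrK mulrC.
rewrite [LHS](_ : _ = (a^-1 * c^-1)%:C%C * (kappa (c / a) * eta (b / c))); last first.
  by rewrite rmorphM /=; ring.
rewrite [RHS](_ : _ = (a^-1 * a^-1 * (a * c^-1))%:C%C * (kappa (c / a) * eta (b / c))); last first.
  by rewrite [in RHS]rmorphM /=; ring.
by congr (_%:C%C * _); field; rewrite a0 c0.
Qed.

(** The entry of the product appears as an arbitrary sum [p] of the series, so that the estimate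
    precedes any choice of operators. *)
Lemma product_defect (m n Kf Kg : R) (Jf Jg : seq R) (kappa eta : R -> R[i]) :
  0 <= m -> 0 <= n -> regular_profile m Kf Jf (profile kappa) ->
  regular_profile n Kg Jg (profile eta) ->
  exists2 C, 0 < C & forall j l (p : R[i]),
    has_csum (fun k => W kappa j k * W eta k l) p ->
    normc (p - W (mconv kappa eta) j l) <= C *
    ((j.+1%:R * l.+1%:R)^-1 * ((1 + ln j.+1%:R) * (1 + ln l.+1%:R)) `^ (m + n + 1)).
Proof.
move=> m0 n0 rf rg; have [C C0 hC] := riemann_sum_integrand m0 n0 rf rg.
exists (2 * C) => [|j l p [pRe pIm]]; first by rewrite mulr_gt0.
set a : R := j.+1%:R; set b : R := l.+1%:R.
have a1 : 1 <= a by rewrite ler1n. have b1 : 1 <= b by rewrite ler1n.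
have a0 : 0 < a by []. have b0 : 0 < b by [].
have [mRe mIm] := measurable_integrand rf rg a0 b0.
have part (rho : R[i] -> R) :
    (forall z w, rho (z - w) = rho z - rho w) -> (forall z, `|rho z| <= normc z) ->
    (forall (r : R) z, rho (r%:C%C * z) = r * rho z) ->
    rho (mconv kappa eta (b / a)) = Rintegral leb (`]0, +oo[%classic : set R)
      (fun u => rho (integrand kappa eta (b / a) u)) ->
    measurable_fun (`]0, +oo[%classic : set R) (fun u => rho (integrand kappa eta (b / a) u)) ->
    series (fun k => rho (W kappa j k * W eta k l)) @ \oo --> rho p ->
    `|rho (p - W (mconv kappa eta) j l)| <=
      C * ((a * b)^-1 * ((1 + ln a) * (1 + ln b)) `^ (m + n + 1)).
  move=> rhoB rho_le rhoZ rhoI mrho cp.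
  have cL : series (fun k => a^-1 * rho (integrand kappa eta (b / a) (a^-1 * k.+1%:R))) @ \oo -->
      a * rho p.
    have -> : series (fun k => a^-1 * rho (integrand kappa eta (b / a) (a^-1 * k.+1%:R))) =
        (fun N => a * series (fun k => rho (W kappa j k * W eta k l)) N).
      apply/funext => N; rewrite /series /= mulr_sumr; apply: eq_bigr => k _.
      by rewrite W_mul_integrand rhoZ mulrA mulrA divff ?gt_eqF// mul1r.
    by apply: cvgM => //; exact: cvg_cst.
  have := hC rho a b _ a1 b1 rhoB rho_le mrho cL.
  rewrite -rhoI rhoB /W rhoZ -/a -/b => h.
  have -> : rho p - a^-1 * rho (mconv kappa eta (b / a)) =
      a^-1 * (a * rho p - rho (mconv kappa eta (b / a))).
    by rewrite mulrBr mulrA mulVf ?gt_eqF// mul1r.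
  rewrite normrM ger0_norm ?invr_ge0 ?(ltW a0)// invfM -mulrA mulrCA.
  by rewrite ler_wpM2l ?invr_ge0 ?(ltW a0).
apply: (le_trans (normc_le_ReIm _)).
rewrite [leRHS](_ : _ = C * ((a * b)^-1 * ((1 + ln a) * (1 + ln b)) `^ (m + n + 1)) +
  C * ((a * b)^-1 * ((1 + ln a) * (1 + ln b)) `^ (m + n + 1))); last by ring.
apply: lerD; apply: part => //.
- exact: ReB.
- exact: normr_Re_le.
- exact: ReM_real.
- exact: ImB.
- exact: normr_Im_le.
- exact: ImM_real.
Qed.

End assembly.

Local Close Scope classical_set_scope.
Local Open Scope complex_scope.
Unset Implicit Arguments.

Theorem theorem4p8 (R : realType) (m n : R) (kappa eta : R -> R[i]) :
  0 <= m -> 0 <= n -> FBV m kappa -> FBV n eta ->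
  exists Wkappa Weta Wconv : {linear hardy R -> hardy R},
    [/\ is_operator_of (W kappa) Wkappa,
        is_operator_of (W eta) Weta,
        is_operator_of (W (mconv kappa eta)) Wconv,
        hilbert_schmidt ((Wkappa \o Weta) \- Wconv)
      & let q := 2 * (m + n + 1) in
        exists2 C : R, 0 < C & forall j l : nat,
          let a : R := j.+1%:R in let b : R := l.+1%:R in
          normc (op_matrix ((Wkappa \o Weta) \- Wconv) j l) <=
            C * ((1 + ln a) `^ q * (1 + ln b) `^ q / (a * b))].
Proof.
move=> m0 n0 /(FBV_regular m0)[Kf [Jf rf]] /(FBV_regular n0)[Kg [Jg rg]].
have [Tk [Tk_bd TkE Tk_sum]] := exists_operator_of_matrix (W_schur_bounded m0 rf).
have [Te [Te_bd TeE _]] := exists_operator_of_matrix (W_schur_bounded n0 rg).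
pose Delta j l := Tk (Te (monomial l)) j - W (mconv kappa eta) j l.
have mn0 : 0 <= m + n + 1 by rewrite !addr_ge0.
have [C C0 hC] := product_defect m0 n0 rf rg.
have DeltaC j l : normc (Delta j l) <=
    C * ((j.+1%:R * l.+1%:R)^-1 * ((1 + ln j.+1%:R) * (1 + ln l.+1%:R)) `^ (m + n + 1)).
  apply: hC; have := Tk_sum (Te (monomial l)) j.
  by under [X in has_csum X _]eq_fun do rewrite TeE.
have [C' C'0 hC'] := polylog_le_root4 mn0.
have DeltaR j l : normc (Delta j l) <= C * C' * (root4 j.+1 ^+ 3 * root4 l.+1 ^+ 3)^-1.
  apply: (le_trans (DeltaC j l)); rewrite -mulrA ler_wpM2l ?(ltW C0)//; exact: hC'.
have CC0 : 0 <= C * C' by rewrite mulr_ge0 ?ltW.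
have Delta_schur : schur_bounded Delta.
  exists (C * C') => // j l; apply: (le_trans (DeltaR j l)).
  by rewrite ler_wpM2l// root4_product_le_schur_kernel.
have [TD [TD_bd TDE _]] := exists_operator_of_matrix Delta_schur.
(* The operator of W(kappa * eta) is defined by subtracting the defect; that its entries are the
   prescribed ones is checked afterwards. *)
pose Tc : {linear hardy R -> hardy R} := (Tk \o Te) \- TD.
have defect F : ((Tk \o Te) \- Tc) F = TD F by rewrite /Tc /= opprB addrC subrK.
have Tc_bd : norm_bounded Tc by apply: norm_boundedB => //; exact: norm_bounded_comp.
exists Tk, Te, Tc; split.
- by split; [exact: norm_bounded_bounded | move=> j k; exact: TkE].
- by split; [exact: norm_bounded_bounded | move=> j k; exact: TeE].
- split; first exact: norm_bounded_bounded.
  move=> j k; rewrite /op_matrix.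
  have -> : Tc (monomial k) j = Tk (Te (monomial k)) j - TD (monomial k) j by [].
  by rewrite TDE /Delta opprB addrC subrK.
- split.
    by apply/norm_bounded_bounded/norm_boundedB => //; exact: norm_bounded_comp.
  under eq_eseriesr => l _.
    have -> : normsq (((Tk \o Te) \- Tc) (monomial l)) = normsq (fun j => Delta j l).
      by rewrite defect; congr normsq; apply/funext => j; exact: TDE.
    over.
  exact: hilbert_schmidt_sum_lty DeltaR.
- move=> q; exists C; first exact: C0.
  move=> j l; cbv zeta.
  have -> : op_matrix ((Tk \o Te) \- Tc) j l = Delta j l.
    exact: (etrans (congr1 (fun F : hardy R => F j) (defect (monomial l))) (TDE l j)).
  apply: (le_trans (DeltaC j l)); rewrite ler_wpM2l ?(ltW C0)// mulrC.
  rewrite ler_wpM2r ?invr_ge0 ?mulr_ge0// -powRM ?addr_ge0 ?ln_ge0 ?ler1n//.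
  (* The exponent m + n + 1 has been reached; the base is at least 1, so it may be raised to q. *)
  apply: ler_powR; last by rewrite /q; lra.
  by rewrite mulr_ege1// lerDl ln_ge0 ?ler1n.
Qed.
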